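(* Let $Z,\kappa\in\mathbb{C}$. The regular distribution $\mathrm{Pf.}\,k_{\mathcal A}(Z,\kappa,r)$ on $\mathbb{R}^3$ is a fundamental solution of the differential operator $\mathcal A=\Delta_3+\frac{2Z}r-2\kappa^2$, i.e. $\mathcal A\,\mathrm{Pf.}\,k_{\mathcal A}(Z,\kappa,\cdot)=\delta$ in $\mathcal D'(\mathbb{R}^3)$.
   Context: $r=|x|$ on $\mathbb{R}^3$. For a function $k$ on $\mathbb{R}^3\setminus\{0\}$ that is locally integrable on $\mathbb{R}^3$, $\mathrm{Pf.}\,k$ is the corresponding regular distribution. In polar coordinates $\mathcal A=r^{-2}[(-r\partial_r)^2-(-r\partial_r)+\Delta_{S^2}+2Zr-2\kappa^2r^2]$. For radial $k$, $\mathcal A\,\mathrm{Pf.}\,k$ is the distribution $g\mapsto\int_{\mathbb{R}^3}(\mathcal Ag)(x)\,k(|x|)\,dx$, $g\in\mathcal D(\mathbb{R}^3)$. **Binary words.** A binary word is a finite sequence $\alpha=(\alpha_1,\dots,\alpha_{N^\alpha})$ with $\alpha_i\in\{1,2\}$; $N^\alpha_Z$ and $N^\alpha_\kappa$ are the numbers of 1's and 2's. $S_p$ is the set of binary words with $\sum_k\alpha_k=p$ ($S_0$ consists of the empty word). $S_{p-1}\lfloor_1$ and $S_{p-2}\lfloor_2$ denote the sets of words obtained by appending a 1, respectively a 2, at the end of each word of $S_{p-1}$, respectively $S_{p-2}$; they consist of the words in $S_p$ ending in 1, respectively 2. For $\alpha\in S_p$ put $p_0=p$, $p_j=p-\sum_{k=1}^j\alpha_k$.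 **The function $k_{\mathcal A}$.** $k_{\mathcal A}(Z,\kappa,r)=\sum_{p=0}^\infty r^pk_p(r)$, with $k_0(r)=-\frac1{4\pi r}$, $k_1(r)=\frac1{4\pi r}2Z\ln(r)$ and for $p\ge2$ $$\begin{aligned}k_p(r)=&-\frac1{4\pi r}\sum_{\alpha\in S_{p-2}\lfloor_2}(-1)^{N_Z^\alpha}2^{N^\alpha}Z^{N_Z^\alpha}(\kappa^2)^{N_\kappa^\alpha}\prod_{j=0}^{N^\alpha-1}\frac1{p_j(p_j-1)}\\&-\frac1{4\pi r}\sum_{\alpha\in S_{p-1}\lfloor_1}(-1)^{N_Z^\alpha}2^{N^\alpha}Z^{N_Z^\alpha}(\kappa^2)^{N_\kappa^\alpha}\prod_{j=0}^{N^\alpha-2}\frac1{p_j(p_j-1)}\Bigl[\ln(r)-\sum_{j=0}^{N^\alpha-2}\Bigl(\frac1{p_j-1}+\frac1{p_j}\Bigr)\Bigr].\end{aligned}$$ *)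

(* Defs.v *)
From HB Require Import structures.
From mathcomp Require Import all_boot all_order all_algebra.
From mathcomp Require Import complex.
From mathcomp Require Import all_classical all_reals all_analysis.

Set Implicit Arguments.
Unset Strict Implicit.
Unset Printing Implicit Defensive.

Import Order.TTheory GRing.Theory Num.Theory.
Import numFieldNormedType.Exports.

Local Open Scope classical_set_scope.
Local Open Scope ring_scope.
Local Open Scope complex_scope.

(** The reals are an arbitrary [R : realType], the complex numbers [R[i]], and
    Euclidean 3-space is [R * R * R] with the product topology. *)

Section Space.
Variable R : realType.
Local Notation R3 := (R * R * R)%type.

(* The library norm of R3 is the max-norm, hence this separate definition. *)
Definition euclid (x : R3) : R :=
  Num.sqrt (x.1.1 ^+ 2 + x.1.2 ^+ 2 + x.2 ^+ 2).

Definition leb3 :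
    {measure set (measurableTypeR R * measurableTypeR R * measurableTypeR R)
      -> \bar R} :=
  ((@lebesgue_measure R \x @lebesgue_measure R) \x @lebesgue_measure R)%E.

Definition basis3 (i : 'I_3) : R3 :=
  ((i == 0%N :> nat)%:R, (i == 1%N :> nat)%:R, (i == 2%N :> nat)%:R).

Definition partial (i : 'I_3) (f : R3 -> R) : R3 -> R :=
  fun x => 'D_(basis3 i) f x.

Definition iter_partial (s : seq 'I_3) (f : R3 -> R) : R3 -> R :=
  foldr partial f s.

Definition smooth (f : R3 -> R) : Prop :=
  forall s : seq 'I_3,
    continuous (iter_partial s f) /\
    forall (x : R3) (i : 'I_3), derivable (iter_partial s f) x (basis3 i).

Definition laplacian (f : R3 -> R) (x : R3) : R :=
  \sum_(i < 3) partial i (partial i f) x.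

Definition ReF (f : R3 -> R[i]) : R3 -> R := fun x => complex.Re (f x).
Definition ImF (f : R3 -> R[i]) : R3 -> R := fun x => complex.Im (f x).

Definition test_function (g : R3 -> R[i]) : Prop :=
  [/\ smooth (ReF g), smooth (ImF g) & compact (closure [set x | g x != 0])].

Definition integrableC (K : set R3) (f : R3 -> R[i]) : Prop :=
  leb3.-integrable K (EFin \o ReF f) /\ leb3.-integrable K (EFin \o ImF f).

Definition integralC (f : R3 -> R[i]) : R[i] :=
  (\int[leb3]_x ReF f x) +i* (\int[leb3]_x ImF f x).

Definition locally_integrableC (f : R3 -> R[i]) : Prop :=
  forall K : set R3, compact K -> integrableC K f.

End Space.

Section Operator.
Variable R : realType.
Local Notation R3 := (R * R * R)%type.
Variables Z kappa : R[i].

Definition laplacianC (g : R3 -> R[i]) (x : R3) : R[i] :=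
  laplacian (ReF g) x +i* laplacian (ImF g) x.

(* At x = 0 the Coulomb term takes the value 0, since 0^-1 = 0. *)
Definition opA (g : R3 -> R[i]) (x : R3) : R[i] :=
  laplacianC g x + 2 * Z / (euclid x)%:C * g x - 2 * kappa ^+ 2 * g x.

Definition opA_Pf_integrand (k : R -> R[i]) (g : R3 -> R[i]) (x : R3) : R[i] :=
  opA g x * k (euclid x).

(* The coefficient 2Z/r is not smooth at 0, so [opA g] need not be a test
   function: the action of the operator on Pf. k is defined by the integral. *)
Definition opA_Pf (k : R -> R[i]) (g : R3 -> R[i]) : R[i] :=
  integralC (opA_Pf_integrand k g).

Definition delta (g : R3 -> R[i]) : R[i] := g 0.

End Operator.

Section Words.

Definition words (p : nat) : set (seq nat) :=
  [set a | all (fun c => (c == 1%N) || (c == 2%N)) a /\ sumn a = p].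

Definition append (c : nat) (A : set (seq nat)) : set (seq nat) :=
  [set rcons a c | a in A].

Definition numZ (a : seq nat) : nat := count_mem 1 a.
Definition numK (a : seq nat) : nat := count_mem 2 a.

(* p_j = p - (a_1 + ... + a_j); the truncation never occurs for a word of
   [words p]. *)
Definition rest (p : nat) (a : seq nat) (j : nat) : nat := p - sumn (take j a).

End Words.

Section Series.
Variable R : realType.
Variables Z kappa : R[i].

Definition weight (a : seq nat) : R[i] :=
  (-1) ^+ numZ a * 2 ^+ size a * Z ^+ numZ a * (kappa ^+ 2) ^+ numK a.

Definition den (p : nat) (a : seq nat) (j : nat) : R :=
  (rest p a j)%:R * ((rest p a j)%:R - 1).

Definition log_bracket (p : nat) (a : seq nat) (r : R) : R :=
  ln r - \sum_(j < (size a).-1)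
           (((rest p a j)%:R - 1)^-1 + ((rest p a j)%:R)^-1).

Definition kp (p : nat) (r : R) : R[i] :=
  let c : R[i] := ((4 * pi * r)^-1)%:C in
  match p with
  | 0 => - c
  | 1 => c * (2 * Z * (ln r)%:C)
  | _ =>
    - c * \sum_(a \in append 2 (words (p - 2)))
            weight a * (\prod_(j < size a) (den p a j)^-1)%:C
    - c * \sum_(a \in append 1 (words (p - 1)))
            weight a * (\prod_(j < (size a).-1) (den p a j)^-1)%:C
                     * (log_bracket p a r)%:C
  end.

Definition kA_term (r : R) (p : nat) : R[i] := (r ^+ p)%:C * kp p r.

(* [R[i]^o] is R[i] with the topology of the complex modulus. *)
Definition kA_partial (r : R) : nat -> R[i]^o := series (kA_term r).

Definition kA (r : R) : R[i] := limn (kA_partial r).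

End Series.

(* Main.v *)
Require Import Defs.
From HB Require Import structures.
From mathcomp Require Import all_boot all_order all_algebra.
From mathcomp Require Import complex.
From mathcomp Require Import all_classical all_reals all_analysis.
From mathcomp Require Import measurable_realfun.
From mathcomp Require Import ring lra zify.

(** Put u(r) = - 4 pi r k_A(r). The term of order p of the defining series contributes
    r^p (a_p + b_p ln r) to u, and splitting off the first letter of each binary word
    yields ([log_coef_rec], [pow_coef_rec])
<<
      p (p-1) b_p             = - 2Z b_(p-1) + 2 kappa^2 b_(p-2)
      p (p-1) a_p + (2p-1) b_p = - 2Z a_(p-1) + 2 kappa^2 a_(p-2)
>>
    for p >= 2, with a_0 = 1, a_1 = 0, b_0 = 0 and b_1 = - 2Z. Hence a_p and b_p are
    O(K^p / p!), so that u is an entire series plus ln r times an entire series, and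
    u'' = (2 kappa^2 - 2Z/r) u. In terms of the flux v = u - r u' = 4 pi r^2 k_A' this is
    v' = 4 pi r^2 q with q = (2 kappa^2 - 2Z/r) k_A: the operator annihilates k_A away
    from the origin. Moreover v(0+) = u(0+) = 1.

    The delta is this limit of the flux. [radial_fundamental] shows for radial k whose flux
    v satisfies v' = 4 pi r^2 q and tends to v0 at 0, under bounds on k, q and v - v0 near 0,
    that the Laplacian of Pf. k is Pf. q + v0 delta. The singularity is removed by replacing
    r with s = sqrt (r^2 + e). Then k(s) is twice differentiable on the whole space, with
    Laplacian
<<
      q(s) (1 - e/s^2) + 3 e v(s) / (4 pi s^5),
>>
    and may be paired with the Laplacian of a test function f: by Fubini's theorem, Green's
    formula is the fundamental theorem of calculus on the lines parallel to the axes
    ([green]). As e tends to 0, the first term tends to q; the kernels 3 e / (4 pi s^5) have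
    integral 1 ([integral_radius5]) and concentrate at the origin, so the second term tends
    to v0 f(0). All limits are instances of dominated convergence with one dominating
    function, the product [dom3] of three functions of one coordinate.

    The pairing of g with k_A is bilinear, so it suffices to pair the real and imaginary
    parts of g with the real functions Re (l k_A) for l = 1 and l = -i
    ([kA_part_fundamental]). *)

Import Order.TTheory GRing.Theory Num.Theory.
Import numFieldNormedType.Exports.
Set Implicit Arguments.
Unset Strict Implicit.
Unset Printing Implicit Defensive.
Local Open Scope classical_set_scope.
Local Open Scope ring_scope.
Local Open Scope complex_scope.

(** * Sums over binary words *)

(** The words of sum p whose last letter is c, listed by first letter: sums over
    the sets of words become sums over a list that recurses on p. *)
Fixpoint words_ending (c p : nat) : seq (seq nat) :=
  match p with
  | 0 => [::]
  | p1.+1 => (if p == c then [:: [:: c]] else [::])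
             ++ map (cons 1%N) (words_ending c p1)
             ++ (if p1 is p2.+1 then map (cons 2%N) (words_ending c p2) else [::])
  end.

Lemma mem_map_cons (d e : nat) (a : seq nat) s :
  (e :: a \in map (cons d) s) = (e == d) && (a \in s).
Proof.
elim: s => [|x s IH]; first by rewrite andbF.
by rewrite /= !inE IH eqseq_cons; case: (e == d).
Qed.

Lemma mem_words_ending c p a : (0 < c <= 2)%N ->
  (a \in words_ending c p) = [&& all (fun d => (d == 1%N) || (d == 2%N)) a,
                          sumn a == p & last 0%N a == c].
Proof.
move=> c12; elim: a p => [|d a IH] p.
  rewrite /= [0%N == c]eq_sym; have -> : (c == 0%N) = false by lia.
  rewrite andbF; case: p => [//|p] /=; rewrite !mem_cat.
  have nc e s : ([::] \in map (cons e) s : bool) = false.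
    by apply/negP => /mapP[].
  rewrite nc; case: p => [|p]; rewrite ?nc; case: ifP => //.
have H (q : nat) : (d :: a \in (if q == c then [:: [:: c]] else [::])) =
    [&& q == c, d == c & a == [::]].
  by case: (q == c); rewrite // inE eqseq_cons.
have L : last d a == c = ((d == c) && (a == [::]) || (last 0%N a == c)).
  by case: a {IH H} => [|x a] /=; rewrite ?andbF ?andbT//; lia.
case: p => [|p].
  rewrite /= in_nil; apply/esym/negbTE; lia.
rewrite [words_ending _ _]/= !mem_cat H mem_map_cons IH.
have -> : (d :: a \in (if p is p2.+1 then map (cons 2%N) (words_ending c p2) else [::]))
   = [&& d == 2%N, (0 < p)%N & a \in words_ending c p.-1].
  by case: p => [|p]; rewrite ?andbF// mem_map_cons.
rewrite IH /= L.
have S0 : a = [::] -> sumn a = 0%N /\ all (fun d : nat => (d == 1%N) || (d == 2%N)) a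
   by move=> ->.
have S1 : last 0%N a == c -> (0 < sumn a)%N \/ ~~ all (fun d : nat => (d == 1%N) || (d == 2%N)) a.
  case/lastP: a {IH H L S0} => [|a x]; first by move=> /eqP /=; lia.
  by rewrite last_rcons -cats1 sumn_cat /=; lia.
move: S0 S1; case: (a =P [::]) => [->/=|_].
  by move=> _ _; lia.
by move=> _ ; case: (last _ _ == c); case: (all _ _) => /=; try lia.
Qed.

Lemma uniq_words_ending c p : uniq (words_ending c p).
Proof.
have inj d : injective (@cons nat d) by move=> x y [].
have nil_notin c' q : (0 < c')%N -> [::] \notin words_ending c' q.
  move=> _; case: q => [//|q] /=; rewrite !mem_cat.
  have nc e s : ([::] \in map (cons e) s : bool) = false by apply/negP => /mapP[].
  by rewrite nc; case: q => [|q]; rewrite ?nc; case: ifP.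
elim/ltn_ind: p => -[//|p] IH /=.
have Hs : uniq (map (cons 1%N) (words_ending c p) ++
   (if p is p2.+1 then map (cons 2%N) (words_ending c p2) else [::])).
  rewrite cat_uniq map_inj_uniq// IH//=.
  case: p IH => [//|p] IH /=; rewrite map_inj_uniq// IH//.
  rewrite andbT; apply/hasPn => x /mapP[y _ ->]; by rewrite mem_map_cons.
case: eqP => [pc|//].
rewrite cat1s cons_uniq Hs andbT mem_cat mem_map_cons.
case: p {IH Hs} pc => [|p] pc; rewrite ?mem_map_cons; have := nil_notin c; rewrite -pc => /(_ _ isT) N.
  by [].
by rewrite !(negbTE (N _)) !andbF.
Qed.

Lemma append_words c p : (0 < c <= 2)%N -> (c <= p)%N ->
  append c (words (p - c)) = [set` words_ending c p].
Proof.
move=> c12 cp; apply/seteqP; split => [a [b [vb sb] <-]|a] /=.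
  rewrite mem_words_ending// all_rcons vb last_rcons eqxx !andbT -cats1 sumn_cat sb /=.
  by lia.
rewrite mem_words_ending//; case/lastP: a => [|b x] /=.
  by case/andP => _; lia.
rewrite all_rcons last_rcons -cats1 sumn_cat /= addn0.
move=> /and3P[/andP[_ vb] /eqP sb /eqP xc]; exists b; last by rewrite cats1 xc.
by split => //; rewrite -sb xc addnK.
Qed.

Lemma words_ending_0 c : words_ending c 0 = [::]. Proof. by []. Qed.
Lemma words_ending_11 : words_ending 1 1 = [:: [:: 1%N]]. Proof. by []. Qed.
Lemma words_ending_21 : words_ending 2 1 = [::]. Proof. by []. Qed.
Lemma words_ending_22 : words_ending 2 2 = [:: [:: 2%N]]. Proof. by []. Qed.
Definition words_ending_small := (words_ending_0, words_ending_11, words_ending_21, words_ending_22).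

Lemma words_ending_SS c p : p.+2 != c ->
  words_ending c p.+2 = map (cons 1%N) (words_ending c p.+1) ++ map (cons 2%N) (words_ending c p).
Proof. by move=> /negbTE pc; rewrite [LHS]/= pc. Qed.

Arguments words_ending : simpl never.

Section Coefficients.
Variable R : realType.
Variables Z kappa : R[i].

Definition inv_dens (n p : nat) (a : seq nat) : R := \prod_(j < n) (den R p a j)^-1.

Definition log_shift (p : nat) (a : seq nat) : R :=
  \sum_(j < (size a).-1) (((rest p a j)%:R - 1)^-1 + ((rest p a j)%:R)^-1).

(** The coefficient of r^p ln r in - 4 pi r k_A(r). *)
Definition log_coef (p : nat) : R[i] :=
  \sum_(a <- words_ending 1 p) weight Z kappa a * (inv_dens (size a).-1 p a)%:C.

Definition ending2_coef (p : nat) : R[i] :=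
  \sum_(a <- words_ending 2 p) weight Z kappa a * (inv_dens (size a) p a)%:C.

Definition shift_coef (p : nat) : R[i] :=
  \sum_(a <- words_ending 1 p)
    weight Z kappa a * (inv_dens (size a).-1 p a)%:C * (log_shift p a)%:C.

(** The coefficient of r^p in - 4 pi r k_A(r); the summand 1 at p = 0 comes from
    k_0 and belongs to no word. *)
Definition pow_coef (p : nat) : R[i] :=
  (p == 0)%:R + ending2_coef p - shift_coef p.

Lemma kp_coefs p r : kp Z kappa p r =
  - ((4 * pi * r)^-1)%:C * (pow_coef p + log_coef p * (ln r)%:C).
Proof.
case: p => [|[|p]].
- by rewrite /kp /pow_coef /ending2_coef /shift_coef /log_coef !words_ending_small /= !big_nil mul0r subr0 !addr0 mulr1.
- rewrite /kp /pow_coef /ending2_coef /shift_coef /log_coef !words_ending_small /= !big_nil !big_seq1 /=.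
  rewrite /inv_dens /log_shift !big_ord0 /weight /numZ /numK /=.
  by rewrite !expr1 !expr0 /=; ring.
rewrite /kp (@append_words 2 p.+2)// (@append_words 1 p.+2)//.
rewrite -!fsbig_seq ?uniq_words_ending//.
rewrite /pow_coef add0r /shift_coef /log_coef /log_bracket.
rewrite -mulNr -mulrDr; congr (_ * _); rewrite -addrA; congr (_ + _).
rewrite big_distrl /= -sumrN -big_split /=; apply: eq_bigr => a _.
by rewrite rmorphB /= -/(log_shift _ _) /inv_dens; ring.
Qed.

Lemma weight_cons1 a : weight Z kappa (1%N :: a) = - (2 * Z) * weight Z kappa a.
Proof. by rewrite /weight /numZ /numK /= add1n add0n !exprS; ring. Qed.

Lemma weight_cons2 a : weight Z kappa (2%N :: a) = 2 * kappa ^+ 2 * weight Z kappa a.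
Proof. by rewrite /weight /numZ /numK /= add1n add0n !exprS; ring. Qed.

Lemma inv_dens_cons n p d a :
  inv_dens n.+1 p (d :: a) = (p%:R * (p%:R - 1))^-1 * inv_dens n (p - d) a.
Proof.
rewrite /inv_dens big_ord_recl /den /rest /= subn0; congr (_ * _).
by apply: eq_bigr => j _; rewrite subnDA.
Qed.

Lemma size_words_ending c p a : (0 < c <= 2)%N -> a \in words_ending c p -> (size a).-1.+1 = size a.
Proof.
move=> c12; rewrite mem_words_ending//; case: a => //=.
by case/andP => _ /eqP; lia.
Qed.

Lemma sum_words_ending (F : seq nat -> R[i]) c p : (p.+2 != c) ->
  \sum_(a <- words_ending c p.+2) F a =
  \sum_(a <- words_ending c p.+1) F (1%N :: a) + \sum_(a <- words_ending c p) F (2%N :: a).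
Proof.
move=> pc; by rewrite words_ending_SS// big_cat !big_map.
Qed.

Let pp (p : nat) : R[i] := (p.+2 * p.+1)%:R.

Lemma inv_pp (p : nat) : ((p.+2%:R * (p.+2%:R - 1) : R)^-1)%:C = (pp p)^-1.
Proof.
rewrite fmorphV /pp natrM rmorphM rmorphB !rmorph_nat rmorph1.
by congr ((_ * _)^-1); rewrite -[p.+2%:R]natr1 addrK.
Qed.

(** The first letter of a word contributes the factor 1/(p (p-1)) and the weight
    - 2Z or 2 kappa^2; the rest is a word of sum p-1 or p-2. *)
Lemma log_coef_rec p : pp p * log_coef p.+2 =
  - (2 * Z) * log_coef p.+1 + 2 * kappa ^+ 2 * log_coef p.
Proof.
have pp0 : pp p != 0 by rewrite pnatr_eq0.
rewrite /log_coef sum_words_ending// mulrDr !big_distrr /=; congr (_ + _).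
all: apply: eq_big_seq => a aw; rewrite -(size_words_ending _ aw)// inv_dens_cons.
  by rewrite weight_cons1 subSS subn0 rmorphM /= inv_pp; move: (pp p) pp0 => P P0; field.
by rewrite weight_cons2 !subSS subn0 rmorphM /= inv_pp; move: (pp p) pp0 => P P0; field.
Qed.

Lemma log_shift_cons p d a : (size a).-1.+1 = size a ->
  log_shift p (d :: a) = (p%:R - 1)^-1 + p%:R^-1 + log_shift (p - d) a.
Proof.
move=> sa; rewrite /log_shift /= -sa big_ord_recl /rest /= subn0; congr (_ + _).
by apply: eq_bigr => j _; rewrite subnDA.
Qed.

(** The first letter also adds 1/(p-1) + 1/p = (2p-1)/(p (p-1)) to the bracket;
    summed against the weights this reproduces [log_coef]. *)
Lemma shift_coef_rec p : pp p * shift_coef p.+2 =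
  - (2 * Z) * shift_coef p.+1 + 2 * kappa ^+ 2 * shift_coef p
  + (2 * p + 3)%:R * log_coef p.+2.
Proof.
have pp0 : pp p != 0 by rewrite pnatr_eq0.
have p1 : (p%:R + 1 : R[i]) != 0 by rewrite natr1 pnatr_eq0.
have p2 : (p%:R + 2 : R[i]) != 0 by rewrite -natrD pnatr_eq0 addn2.
apply: (mulfI pp0); rewrite [RHS]mulrDr [pp p * (_ * log_coef _)]mulrCA log_coef_rec.
have H : (((p.+2%:R - 1)^-1 + p.+2%:R^-1 : R))%:C = (2 * p + 3)%:R / pp p.
  rewrite rmorphD /= !fmorphV rmorphB /= !rmorph_nat /pp natrM natrD natrM.
  rewrite -[p.+2%:R]natr1 -[p.+1%:R]natr1; field.
  by rewrite p1 -addrA p2.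
rewrite /shift_coef /log_coef sum_words_ending// 2!mulrDr !big_distrr /= 2!mulrDr !big_distrr /=.
rewrite addrACA -!big_split /=; congr (_ + _).
all: apply: eq_big_seq => a aw.
all: rewrite log_shift_cons ?(size_words_ending _ aw)//.
all: rewrite -(size_words_ending _ aw)// inv_dens_cons !rmorphM /= inv_pp.
  by rewrite weight_cons1 subSS subn0 rmorphD /= H; move: (pp p) pp0 => P P0; field.
by rewrite weight_cons2 !subSS subn0 rmorphD /= H; move: (pp p) pp0 => P P0; field.
Qed.

Lemma log_coef0 : log_coef 0 = 0. Proof. by rewrite /log_coef !words_ending_small big_nil. Qed.
Lemma pow_coef0 : pow_coef 0 = 1.
Proof. by rewrite /pow_coef /ending2_coef /shift_coef !words_ending_small !big_nil subr0 addr0. Qed.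
Lemma log_coef1 : log_coef 1 = - (2 * Z).
Proof.
rewrite /log_coef !words_ending_small /= !big_seq1 /inv_dens big_ord0 /weight /numZ /numK /=.
by rewrite !expr1 !expr0 /=; ring.
Qed.
Lemma pow_coef1 : pow_coef 1 = 0.
Proof.
rewrite /pow_coef /ending2_coef /shift_coef !words_ending_small !big_nil big_seq1 /log_shift big_ord0.
by rewrite mulr0 subr0 addr0.
Qed.

Lemma ending2_coef_rec p : pp p * ((p.+2 == 0)%:R + ending2_coef p.+2) =
  - (2 * Z) * ((p.+1 == 0)%:R + ending2_coef p.+1) + 2 * kappa ^+ 2 * ((p == 0)%:R + ending2_coef p).
Proof.
have pp0 : pp p != 0 by rewrite pnatr_eq0.
rewrite !add0r /ending2_coef; case: p pp0 => [|p] pp0.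
  rewrite !words_ending_small /= !big_nil !big_seq1 /weight /numZ /numK /inv_dens /= big_ord_recl big_ord0.
  rewrite /den /rest /= subn0 rmorphM /= inv_pp expr0 expr1.
  by field.
rewrite sum_words_ending// add0r mulrDr !big_distrr /=; congr (_ + _).
all: apply: eq_big_seq => a aw; rewrite inv_dens_cons.
  by rewrite weight_cons1 subSS subn0 rmorphM /= inv_pp; move: (pp _) pp0 => P P0; field.
by rewrite weight_cons2 !subSS subn0 rmorphM /= inv_pp; move: (pp _) pp0 => P P0; field.
Qed.

Lemma pow_coef_rec p : pp p * pow_coef p.+2 =
  - (2 * Z) * pow_coef p.+1 + 2 * kappa ^+ 2 * pow_coef p
  - (2 * p + 3)%:R * log_coef p.+2.
Proof. by rewrite /pow_coef mulrBr ending2_coef_rec shift_coef_rec; ring. Qed.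

End Coefficients.

(** * Power series with coefficients of exponential type *)

Section PowerSeries.
Variable R : realType.
Implicit Types (a b c : nat -> R) (x s : R).

(** Coefficients dominated by those of C exp(K s): a class that is closed under
    differentiation, shifts and multiplication by the index, and whose series
    converge on the whole line. *)
Definition entire c := exists C K : R,
  [/\ 0 <= C, 0 <= K & forall n, `|c n| <= C * exp_coeff K n].

Definition pseries_sum c s : R := limn (pseries c s).

Lemma exp_coeffS x n : n.+1%:R * exp_coeff x n.+1 = x * exp_coeff x n.
Proof.
rewrite /exp_coeff /= factS natrM exprS invfM.
have n0 : (n.+1%:R : R) != 0 by rewrite pnatr_eq0.
have f0 : (n`!%:R : R) != 0 by rewrite pnatr_eq0 -lt0n fact_gt0.
by field; rewrite f0 ?natr1 ?nat1r n0.
Qed.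

Lemma le_exp_coeff x y n : 0 <= x -> x <= y -> exp_coeff x n <= exp_coeff y n.
Proof.
move=> x0 xy; rewrite /exp_coeff /= ler_wpM2r ?invr_ge0 ?ler0n//.
by apply: lerXn2r => //; rewrite nnegrE// (le_trans x0).
Qed.

Lemma entire_lin x y a b : entire a -> entire b -> entire (fun n => x * a n + y * b n).
Proof.
move=> [A [K [A0 K0 HA]]] [B [L [B0 L0 HB]]].
exists (`|x| * A + `|y| * B), (K + L); split.
- by rewrite addr_ge0// mulr_ge0.
- by rewrite addr_ge0.
move=> n; apply: (le_trans (ler_normD _ _)); rewrite !normrM mulrDl -!mulrA lerD//.
  rewrite ler_wpM2l// (le_trans (HA n))// ler_wpM2l//.
  by apply: le_exp_coeff => //; rewrite lerDl.
rewrite ler_wpM2l// (le_trans (HB n))// ler_wpM2l//.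
by apply: le_exp_coeff => //; rewrite lerDr.
Qed.

Lemma entire_diffs c : entire c -> entire (pseries_diffs c).
Proof.
move=> [A [K [A0 K0 HA]]]; exists (A * K), K; split => //; first by rewrite mulr_ge0.
move=> n; rewrite /pseries_diffs normrM normr_nat.
rewrite -mulrA -exp_coeffS mulrCA ler_wpM2l// ?ler0n//.
Qed.

Lemma entire_shift c : entire c -> entire (fun n => c n.+1).
Proof.
move=> /entire_diffs [A [K [A0 K0 HA]]]; exists A, K; split => // n.
apply: le_trans (HA n); rewrite /pseries_diffs normrM normr_nat.
by rewrite ler_peMl// ler1n.
Qed.

Lemma entire_unshift c : entire (fun n => c n.+1) -> entire c.
Proof.
move=> [A [K [A0 K0 HA]]]; exists (`|c 0%N| + A), (K + 1); split.
- by rewrite addr_ge0.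
- by rewrite addr_ge0.
case=> [|n]; first by rewrite /exp_coeff /= expr0 fact0 divr1 mulr1 lerDl.
apply: (le_trans (HA n)).
(* This amounts to (n+1) K^n <= (K+1)^(n+1). *)
have H : exp_coeff K n <= exp_coeff (K + 1) n.+1.
  have n1 : (0 : R) < n.+1%:R by rewrite ltr0n.
  rewrite -(ler_pM2l n1) exp_coeffS /exp_coeff /= !mulrA ler_wpM2r ?invr_ge0 ?ler0n//.
  elim: n {HA} n1 => [|n IH] n1; first by rewrite !expr0 !mulr1 lerDr.
  have IH' := IH (ltr0Sn _ _); rewrite -[n.+2%:R]natr1 mulrDl mul1r [leRHS]mulrDl mul1r.
  apply: lerD; last by apply: lerXn2r; rewrite ?nnegrE ?lerDl ?addr_ge0.
  by rewrite exprS mulrCA ler_wpM2l// [in leRHS]exprS.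
apply: le_trans (_ : A * exp_coeff (K + 1) n.+1 <= _); first by rewrite ler_wpM2l.
by rewrite ler_wpM2r ?lerDr// exp_coeff_ge0 // addr_ge0.
Qed.

Lemma entire_euler c : entire c -> entire (fun n => n%:R * c n).
Proof. by move=> ec; apply: entire_unshift; exact: entire_diffs. Qed.

Lemma entire_cvg c s : entire c -> pseries c s @ \oo --> pseries_sum c s.
Proof.
move=> [A [K [A0 K0 HA]]]; suff : cvgn (pseries c s) by [].
apply: normed_cvg.
apply: (@series_le_cvg _ (fun n => `|c n * s ^+ n|) (fun n => A * exp_coeff (K * `|s|) n)) => //.
- by move=> n; rewrite mulr_ge0// exp_coeff_ge0// mulr_ge0.
- move=> n; rewrite normrM normrX.
  rewrite (_ : exp_coeff _ _ = exp_coeff K n * `|s| ^+ n); last first.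
    by rewrite /exp_coeff /= exprMn mulrAC.
  by rewrite mulrA ler_wpM2r ?exprn_ge0.
have -> : (fun n => A * exp_coeff (K * `|s|) n) = A \*: exp_coeff (K * `|s|) by [].
apply: is_cvg_seriesZ; exact: is_cvg_series_exp_coeff.
Qed.

Lemma is_derive_pseries_sum c s : entire c -> is_derive s 1 (pseries_sum c) (pseries_sum (pseries_diffs c) s).
Proof.
move=> ec; apply: (@pseries_snd_diffs _ c (`|s| + 1) s).
- by have /cvgP := entire_cvg (s := `|s| + 1) ec.
- by have /cvgP := entire_cvg (s := `|s| + 1) (entire_diffs ec).
- by have /cvgP := entire_cvg (s := `|s| + 1) (entire_diffs (entire_diffs ec)).
by rewrite [`|_ + 1|]ger0_norm ?ltrDl// addr_ge0.
Qed.

Lemma pseries_sum_lin x y a b s : entire a -> entire b ->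
  pseries_sum (fun n => x * a n + y * b n) s = x * pseries_sum a s + y * pseries_sum b s.
Proof.
move=> ea eb; apply/cvg_lim => //.
have -> : pseries (fun n => x * a n + y * b n) s =
   (fun n => x * pseries a s n + y * pseries b s n).
  apply/funext => n; rewrite /pseries /series /= !big_distrr -big_split /=.
  by apply: eq_bigr => i _; ring.
apply: cvgD; apply: cvgMr; exact: entire_cvg.
Qed.

Lemma pseries_sum_shift c s : entire c -> pseries_sum c s = c 0%N + s * pseries_sum (fun n => c n.+1) s.
Proof.
move=> ec; apply/cvg_lim => //; rewrite -cvg_shiftS.
have -> : (fun n => pseries c s n.+1) =
   (fun n => c 0%N + s * pseries (fun n => c n.+1) s n).
  apply/funext => n; rewrite /pseries /series /= big_nat_recl// expr0 mulr1.
  by congr (_ + _); rewrite big_distrr /=; apply: eq_bigr => i _; rewrite exprS; ring.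
apply: cvgD; first exact: cvg_cst.
by apply: cvgMr; apply: entire_cvg; exact: entire_shift.
Qed.

Lemma pseries_sum_euler c s : entire c -> pseries_sum (fun n => n%:R * c n) s = s * pseries_sum (pseries_diffs c) s.
Proof. by move=> ec; rewrite pseries_sum_shift ?mul0r ?add0r//; exact: entire_euler. Qed.

(** On sums of a_n s^n plus ln s times sums of b_n s^n, the Euler operator
    s d/ds acts by (a_n, b_n) |-> (n a_n + b_n, n b_n). *)
Lemma is_derive_log_series a b s : entire a -> entire b -> 0 < s ->
  is_derive s 1 (fun t => pseries_sum a t + pseries_sum b t * ln t)
   ((pseries_sum (fun n => n%:R * a n + b n) s + pseries_sum (fun n => n%:R * b n) s * ln s) / s).
Proof.
move=> ea eb s0.
have da := is_derive_pseries_sum s ea; have db := is_derive_pseries_sum s eb; have dl := is_derive1_ln s0.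
have -> : (fun n => n%:R * a n + b n) = (fun n => 1 * (n%:R * a n) + 1 * b n).
  by apply/funext => n; rewrite !mul1r.
rewrite pseries_sum_lin//; last exact: entire_euler.
rewrite !pseries_sum_euler//.
have := is_deriveD da (is_deriveM db dl).
congr is_derive; rewrite /GRing.scale /=; have s1 : s != 0 by rewrite gt_eqF.
by field.
Qed.

Lemma pseries_sum_bounded c S : entire c -> exists2 C, 0 <= C & forall s, 0 <= s <= S -> `|pseries_sum c s| <= C.
Proof.
move=> ec.
have cc : {within `[0, S], continuous (pseries_sum c)}.
  apply: continuous_subspaceT => s; apply: differentiable_continuous.
  by apply/derivable1_diffP; have [] := is_derive_pseries_sum s ec.
have /compact_bounded[M [_ HM]] := continuous_compact cc (@segment_compact _ 0 S).
exists (`|M| + 1); first by rewrite addr_ge0.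
move=> s s0S; apply: (HM (`|M| + 1)).
  by rewrite (le_lt_trans (ler_norm M))// ltrDl.
by exists s => //=; rewrite in_itv.
Qed.

Definition root4 s := Num.sqrt (Num.sqrt s).

Lemma root4_ge0 s : 0 <= root4 s. Proof. exact: sqrtr_ge0. Qed.
Lemma root4_gt0 s : 0 < s -> 0 < root4 s. Proof. by move=> s0; rewrite !sqrtr_gt0. Qed.
Lemma root4K s : 0 <= s -> root4 s ^+ 4 = s.
Proof. by move=> s0; rewrite (exprM _ 2 2) !sqr_sqrtr// sqrtr_ge0. Qed.

Lemma ln_root4 s : 0 < s -> `|ln s| <= 4 * (root4 s + (root4 s)^-1).
Proof.
move=> s0; have r0 := root4_gt0 s0.
have -> : ln s = 4 * ln (root4 s).
  by rewrite -[in LHS](root4K (ltW s0)) lnXn// mulr_natl.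
rewrite normrM ger0_norm// ler_wpM2l//.
have H t : 0 < t -> ln t <= t by move=> t0; rewrite ltW// ln_sublinear.
have /H := r0; have : 0 < (root4 s)^-1 by rewrite invr_gt0.
move=> /[dup] iv /H; rewrite lnV ?posrE// => h1 h2.
by rewrite ler_norml; apply/andP; split; lra.
Qed.

(** As b_0 = 0 the deviation is O(s (1 + |ln s|)), and s^(3/4) absorbs the
    logarithm by [ln_root4]. *)
Lemma log_series_estimate a b S : entire a -> entire b -> b 0%N = 0 ->
  exists2 C, 0 <= C & forall s, 0 < s <= S ->
    `|pseries_sum a s + pseries_sum b s * ln s - a 0%N| <= C * root4 s ^+ 3.
Proof.
move=> ea eb b0.
have [A A0 HA] := pseries_sum_bounded S (entire_shift ea).
have [B B0 HB] := pseries_sum_bounded S (entire_shift eb).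
exists (root4 S * A + 4 * (root4 S ^+ 2 + 1) * B).
  by rewrite addr_ge0// mulr_ge0 ?root4_ge0// mulr_ge0// addr_ge0// exprn_ge0 ?root4_ge0.
move=> s /andP[s0 sS]; have sS' : 0 <= s <= S by rewrite ltW.
rewrite [pseries_sum a s]pseries_sum_shift// [pseries_sum b s]pseries_sum_shift// b0 add0r.
have -> u v w : a 0%N + u + v * w - a 0%N = u + v * w by ring.
apply: (le_trans (ler_normD _ _)); rewrite !normrM (gtr0_norm s0).
have := HA _ sS'; have := HB _ sS'; have := ln_root4 s0.
have r0 := root4_gt0 s0.
have rS : root4 s <= root4 S by rewrite !ler_wsqrtr.
have := root4K (ltW s0).
move: (pseries_sum _ s) (pseries_sum _ s) (ln s) (root4 s) (root4 S) r0 rS => P Q l t T t0 tT <- Hl HQ HP.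
have T0 : 0 <= T by rewrite (le_trans (ltW t0)).
rewrite mulrDl lerD//.
  rewrite [t ^+ 4]exprS [leRHS]mulrAC -[leLHS]mulrA -[leRHS]mulrA; apply: ler_pM => //; rewrite ?(ltW t0)//.
    by rewrite mulr_ge0// ltW// exprn_gt0.
  by rewrite ler_wpM2l// ltW// exprn_gt0.
apply: (@le_trans _ _ (t ^+ 4 * B * (4 * (t + t^-1)))).
  apply: ler_pM => //; first by rewrite mulr_ge0// ltW// exprn_gt0.
  by rewrite ler_wpM2l// ltW// exprn_gt0.
have -> : t ^+ 4 * B * (4 * (t + t^-1)) = 4 * B * t ^+ 3 * (t ^+ 2 + 1).
  by have t1 : t != 0 := lt0r_neq0 t0; field.
have -> : 4 * (T ^+ 2 + 1) * B * t ^+ 3 = 4 * B * t ^+ 3 * (T ^+ 2 + 1) by ring.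
apply: ler_wpM2l; first by rewrite !mulr_ge0// ltW// exprn_gt0.
by rewrite lerD2r; apply: lerXn2r => //; rewrite nnegrE ltW.
Qed.

End PowerSeries.

(** * Complex coefficients *)

Section ComplexSeries.
Variable R : realType.
Implicit Types (a b c d : nat -> R[i]) (s : R) (z w : R[i]).

Definition entireC c := entire (fun n => complex.Re (c n)) /\ entire (fun n => complex.Im (c n)).

Definition pseries_sumC c s : R[i] :=
  pseries_sum (fun n => complex.Re (c n)) s +i* pseries_sum (fun n => complex.Im (c n)) s.

Lemma le_Re_norm z : `|complex.Re z| <= ComplexField.Normc.normc z.
Proof. by case: z => x y /=; rewrite -sqrtr_sqr ler_wsqrtr // lerDl sqr_ge0. Qed.

Lemma le_Im_norm z : `|complex.Im z| <= ComplexField.Normc.normc z.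
Proof. by case: z => x y /=; rewrite -sqrtr_sqr ler_wsqrtr // lerDr sqr_ge0. Qed.

Lemma entireC_norm c : entire (fun n => ComplexField.Normc.normc (c n)) -> entireC c.
Proof.
move=> [A [K [A0 K0 H]]]; split; exists A, K; split => // n.
all: apply: le_trans (le_trans (ler_norm _) (H n)).
  exact: le_Re_norm.
exact: le_Im_norm.
Qed.

Lemma ReE z w : complex.Re (z * w) = complex.Re z * complex.Re w - complex.Im z * complex.Im w.
Proof. by case: z w => [? ?] [? ?]. Qed.
Lemma ImE z w : complex.Im (z * w) = complex.Re z * complex.Im w + complex.Im z * complex.Re w.
Proof. by case: z w => [? ?] [? ?]. Qed.
Lemma ReD z w : complex.Re (z + w) = complex.Re z + complex.Re w.
Proof. by case: z w => [? ?] [? ?]. Qed.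
Lemma ImD z w : complex.Im (z + w) = complex.Im z + complex.Im w.
Proof. by case: z w => [? ?] [? ?]. Qed.

Lemma entireC_lin z w a b : entireC a -> entireC b -> entireC (fun n => z * a n + w * b n).
Proof.
move=> [ra ia] [rb ib]; split.
  have := entire_lin 1 1 (entire_lin (complex.Re z) (- complex.Im z) ra ia)
     (entire_lin (complex.Re w) (- complex.Im w) rb ib).
  by congr entire; apply/funext => n; rewrite ReD !ReE; ring.
have := entire_lin 1 1 (entire_lin (complex.Re z) (complex.Im z) ia ra)
     (entire_lin (complex.Re w) (complex.Im w) ib rb).
by congr entire; apply/funext => n; rewrite ImD !ImE; ring.
Qed.

Lemma pseries_sumC_lin z w a b s : entireC a -> entireC b ->
  pseries_sumC (fun n => z * a n + w * b n) s = z * pseries_sumC a s + w * pseries_sumC b s.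
Proof.
move=> [ra ia] [rb ib]; apply/eqP; rewrite eq_complex; apply/andP; split; apply/eqP.
  rewrite ReD !ReE /=.
  have -> : (fun n => complex.Re (z * a n + w * b n)) = (fun n =>
     1 * (complex.Re z * complex.Re (a n) + - complex.Im z * complex.Im (a n)) +
     1 * (complex.Re w * complex.Re (b n) + - complex.Im w * complex.Im (b n))).
    by apply/funext => n; rewrite ReD !ReE; ring.
  by rewrite !pseries_sum_lin//; try exact: entire_lin; ring.
rewrite ImD !ImE /=.
have -> : (fun n => complex.Im (z * a n + w * b n)) = (fun n =>
   1 * (complex.Re z * complex.Im (a n) + complex.Im z * complex.Re (a n)) +
   1 * (complex.Re w * complex.Im (b n) + complex.Im w * complex.Re (b n))).
  by apply/funext => n; rewrite ImD !ImE; ring.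
by rewrite !pseries_sum_lin//; try exact: entire_lin; ring.
Qed.

Lemma pseries_sumC_shift c s : entireC c -> pseries_sumC c s = c 0%N + s%:C * pseries_sumC (fun n => c n.+1) s.
Proof.
move=> [rc ic]; rewrite {1}/pseries_sumC [pseries_sum (fun n => complex.Re (c n)) s]pseries_sum_shift//.
rewrite [pseries_sum (fun n => complex.Im (c n)) s]pseries_sum_shift//.
apply/eqP; rewrite eq_complex; apply/andP; split; apply/eqP.
  by rewrite ReD !ReE /=; ring.
by rewrite ImD !ImE /=; ring.
Qed.

Lemma entireC_unshift c : entireC (fun n => c n.+1) -> entireC c.
Proof. by move=> [rc ic]; split; exact: entire_unshift. Qed.

Lemma Re_natM (n : nat) z : complex.Re (n%:R * z) = n%:R * complex.Re z.
Proof. by rewrite -[n%:R in LHS](rmorph_nat (real_complex R)) ReE /= mul0r subr0. Qed.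
Lemma Im_natM (n : nat) z : complex.Im (n%:R * z) = n%:R * complex.Im z.
Proof. by rewrite -[n%:R in LHS](rmorph_nat (real_complex R)) ImE /= mul0r addr0. Qed.

Lemma entireC_euler c : entireC c -> entireC (fun n => n%:R * c n).
Proof.
move=> [/entire_euler rc /entire_euler ic]; split.
  by move: rc; congr entire; apply/funext => n; rewrite Re_natM.
by move: ic; congr entire; apply/funext => n; rewrite Im_natM.
Qed.

Lemma entireC_add a b : entireC a -> entireC b -> entireC (fun n => a n + b n).
Proof.
move=> ea eb; have := entireC_lin 1 1 ea eb; congr entireC.
by apply/funext => n; rewrite !mul1r.
Qed.

Definition log_series a b s : R[i] := pseries_sumC a s + pseries_sumC b s * (ln s)%:C.

Lemma log_series_lin z w a b c d s : entireC a -> entireC b -> entireC c -> entireC d ->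
  log_series (fun n => z * a n + w * c n) (fun n => z * b n + w * d n) s =
  z * log_series a b s + w * log_series c d s.
Proof. by move=> *; rewrite /log_series !pseries_sumC_lin//; ring. Qed.

Lemma log_series_shift a b s : entireC a -> entireC b -> a 0%N = 0 -> b 0%N = 0 ->
  log_series a b s = s%:C * log_series (fun n => a n.+1) (fun n => b n.+1) s.
Proof.
move=> ea eb a0 b0; rewrite /log_series [pseries_sumC a s]pseries_sumC_shift// [pseries_sumC b s]pseries_sumC_shift// a0 b0.
by ring.
Qed.

Lemma Re_log_series a b s : complex.Re (log_series a b s) =
  pseries_sum (fun n => complex.Re (a n)) s + pseries_sum (fun n => complex.Re (b n)) s * ln s.
Proof. by rewrite /log_series ReD ReE /= mulr0 subr0. Qed.

(** The multiplier l treats real and imaginary parts at once: they are the cases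
    l = 1 and l = -i. *)
Lemma is_derive_Re_log_series l a b s : entireC a -> entireC b -> 0 < s ->
  is_derive s 1 (fun t => complex.Re (l * log_series a b t))
   (complex.Re (l * log_series (fun n => n%:R * a n + b n) (fun n => n%:R * b n) s) / s).
Proof.
move=> ea eb s0.
have eb' := entireC_euler eb; have ea' := entireC_add (entireC_euler ea) eb.
have H c d t : entireC c -> entireC d -> complex.Re (l * log_series c d t) =
    pseries_sum (fun n => complex.Re (l * c n + 0 * c n)) t +
    pseries_sum (fun n => complex.Re (l * d n + 0 * d n)) t * ln t.
  move=> ec ed; rewrite -(Re_log_series (fun n => l * c n + 0 * c n)).
  by rewrite log_series_lin// mul0r addr0.
under eq_fun do rewrite H//.
rewrite H//.
have := is_derive_log_series (proj1 (entireC_lin l 0 ea ea)) (proj1 (entireC_lin l 0 eb eb)) s0.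
congr (is_derive _ _ _ ((pseries_sum _ _ + pseries_sum _ _ * _) / _)); apply/funext => n.
  by rewrite -Re_natM -ReD; congr complex.Re; ring.
by rewrite -Re_natM; congr complex.Re; ring.
Qed.

Lemma Re_log_series_estimate l a b S : entireC a -> entireC b -> b 0%N = 0 ->
  exists2 C, 0 <= C & forall s, 0 < s <= S ->
    `|complex.Re (l * log_series a b s) - complex.Re (l * a 0%N)| <= C * root4 s ^+ 3.
Proof.
move=> ea eb b0.
have [|C C0 HC] := log_series_estimate S (proj1 (entireC_lin l 0 ea ea))
   (proj1 (entireC_lin l 0 eb eb)).
  by rewrite /= b0 !mulr0 addr0.
exists C => // s sS; apply: le_trans (HC s sS).
rewrite -(Re_log_series (fun n => l * a n + 0 * a n) (fun n => l * b n + 0 * b n)).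
by rewrite log_series_lin//= !mul0r !addr0.
Qed.

Lemma cvg_complex (x y : nat -> R) lx ly : x @ \oo --> lx -> y @ \oo --> ly ->
  (fun n => x n +i* y n : R[i]^o) @ \oo --> (lx +i* ly : R[i]^o).
Proof.
move=> cx cy; apply/cvgrPdist_lt => -[e1 e2] /=.
rewrite ltcE /= => /andP[/eqP -> e0].
have e2p : 0 < e1 / 2 by rewrite divr_gt0.
move/cvgrPdist_lt : cx => /(_ _ e2p); move/cvgrPdist_lt : cy => /(_ _ e2p) cy cx.
near=> n.
have hx : `|lx - x n| < e1 / 2 by near: n.
have hy : `|ly - y n| < e1 / 2 by near: n.
rewrite normc_def ltcE /= eqxx /=.
apply: le_lt_trans (_ : `|lx - x n| + `|ly - y n| < e1); last by rewrite [ltRHS](splitr e1) ltrD.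
rewrite -[leRHS]ger0_norm ?addr_ge0// -sqrtr_sqr ler_wsqrtr//.
rewrite -(real_normK (num_real (lx - x n))) -(real_normK (num_real (ly - y n))).
by rewrite sqrrD lerD2r lerDl mulrn_wge0// mulr_ge0.
Unshelve. all: by end_near. Qed.

Lemma cvg_pseries_sumC c s : entireC c ->
  (series (fun n => c n * (s ^+ n)%:C) : nat -> R[i]^o) @ \oo --> (pseries_sumC c s : R[i]^o).
Proof.
move=> [rc ic].
have := cvg_complex (entire_cvg (s := s) rc) (entire_cvg (s := s) ic).
set f := (fun n => _ +i* _); suff -> : series (fun n => c n * (s ^+ n)%:C) = f by [].
apply/funext => n; rewrite /f /pseries /series /=.
elim: n => [|n IH]; first by rewrite !big_geq.
rewrite !big_nat_recr//= IH; apply/eqP; rewrite eq_complex /=.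
by rewrite ReD ImD ReE ImE /= !mulr0 subr0 add0r !eqxx.
Qed.

End ComplexSeries.

(** * The radial function k_A and its flux *)

(** By induction x_p <= C K^p / p!: each step gains 1/(p (p-1)), and K is so large
    that M K + M <= K^2 / 2, which leaves half of the bound to y. *)
Lemma entire_of_rec (R : realType) (M : R) (x y : nat -> R) :
  0 <= M -> (forall n, 0 <= x n) -> entire y ->
  (forall p, (p.+2 * p.+1)%:R * x p.+2 <=
     M * (x p.+1 + x p) + (2 * p + 3)%:R * `|y p.+2|) ->
  entire x.
Proof.
move=> M0 x0 [D [L [D0 L0 HD]]] rec.
pose K := L + 4 * M + 1; pose C := x 0%N + x 1%N + 4 * D.
have K1 : 1 <= K by rewrite /K lerDr addr_ge0// mulr_ge0.
have K0 : 0 <= K by rewrite (le_trans _ K1).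
have C0 : 0 <= C by rewrite /C !addr_ge0// mulr_ge0.
have e0 n : 0 <= exp_coeff K n by apply: exp_coeff_ge0.
suff H n : x n <= C * exp_coeff K n /\ x n.+1 <= C * exp_coeff K n.+1.
  exists C, K; split => // n; rewrite ger0_norm//.
  by have [] := H n.
elim: n => [|n [IH0 IH1]].
  have H4 := x0 0%N; have H5 := x0 1%N.
  rewrite /exp_coeff /= expr0 expr1 /= !divr1 mulr1; split; first by rewrite /C; lra.
  by apply: (@le_trans _ _ C); rewrite ?ler_peMr// /C; lra.
split=> //.
have pp0 : 0 < (n.+2 * n.+1)%:R :> R by rewrite ltr0n.
rewrite -(ler_pM2l pp0); apply: (le_trans (rec n)).
have H2 : (n.+2 * n.+1)%:R * exp_coeff K n.+2 = K ^+ 2 * exp_coeff K n.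
  by rewrite natrM mulrAC mulrC exp_coeffS mulrCA exp_coeffS; ring.
have H1 := exp_coeffS K n.
have Hy : `|y n.+2| <= D * exp_coeff K n.+2.
  rewrite (le_trans (HD _))// ler_wpM2l// le_exp_coeff// /K -addrA lerDl addr_ge0// mulr_ge0//.
have H3 : (2 * n + 3)%:R * `|y n.+2| <= 2 * D * (K ^+ 2 * exp_coeff K n).
  rewrite -H2; apply: (@le_trans _ _ ((2 * (n.+2 * n.+1))%:R * (D * exp_coeff K n.+2))).
    by apply: ler_pM => //; rewrite ler_nat; lia.
  by rewrite natrM le_eqVlt; apply/orP; left; apply/eqP; ring.
have H4 : x n.+1 <= C * (K * exp_coeff K n).
  apply: (le_trans IH1); rewrite ler_wpM2l// -H1 ler_peMl// ler1n//.
rewrite [leRHS]mulrCA H2.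
have Dc : 4 * D <= C by rewrite /C lerDr addr_ge0.
have := e0 n; move: (exp_coeff K n) H3 H4 IH0 => e H3 H4 H5 e0'.
have H6 : M * (x n.+1 + x n) <= M * (C * (K * e) + C * e).
  by rewrite ler_wpM2l// lerD.
have KM : M * K + M <= K ^+ 2 / 2.
  have : 4 * M <= K - 1 by rewrite /K addrK lerDr.
  by nra.
apply: (le_trans (lerD H6 H3)).
have -> : M * (C * (K * e) + C * e) + 2 * D * (K ^+ 2 * e) = e * (C * (M * K + M) + 4 * D * (K ^+ 2 / 2)).
  by field.
have -> : C * (K ^+ 2 * e) = e * (C * (K ^+ 2 / 2) + C * (K ^+ 2 / 2)) by field.
rewrite ler_wpM2l// lerD// ?ler_wpM2l// ler_wpM2r// divr_ge0// exprn_ge0//.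
Qed.

Section RadialSolution.
Variable R : realType.
Variables Z kappa : R[i].
Local Notation normc := ComplexField.Normc.normc.
Local Notation a := (pow_coef Z kappa).
Local Notation b := (log_coef Z kappa).
Implicit Types (s : R) (l : R[i]).

Lemma normc_nat n : normc (n%:R : R[i]) = n%:R.
Proof.
rewrite -[n%:R](rmorph_nat (real_complex R)) /= expr0n /= addr0 sqrtr_sqr.
by rewrite ger0_norm.
Qed.

Lemma normc_ge0 (z : R[i]) : 0 <= normc z.
Proof. by case: z => x y; rewrite sqrtr_ge0. Qed.

Lemma entire_log_coef_norm : entire (fun n => normc (b n)).
Proof.
apply: (@entire_of_rec R (normc (2 * Z) + normc (2 * kappa ^+ 2)) _ (fun=> 0)).
- by rewrite addr_ge0// normc_ge0.
- by move=> n; exact: normc_ge0.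
- exists 0, 0; split => // n; by rewrite normr0 mul0r.
move=> p; rewrite normr0 mulr0 addr0 -normc_nat -ComplexField.Normc.normcM log_coef_rec.
apply: (le_trans (le_normcD _ _)); rewrite [leRHS]mulrDl lerD// ComplexField.Normc.normcM.
  by rewrite normcN ler_wpM2l ?normc_ge0// lerDl normc_ge0.
by rewrite ler_wpM2l ?normc_ge0// lerDr normc_ge0.
Qed.

Lemma entireC_log_coef : entireC b.
Proof. exact: entireC_norm entire_log_coef_norm. Qed.

Lemma entireC_pow_coef : entireC a.
Proof.
apply: entireC_norm.
apply: (@entire_of_rec R (normc (2 * Z) + normc (2 * kappa ^+ 2)) _ (fun n => normc (b n))).
- by rewrite addr_ge0// normc_ge0.
- by move=> n; exact: normc_ge0.
- exact: entire_log_coef_norm.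
move=> p; rewrite ger0_norm ?normc_ge0// -2!normc_nat -!ComplexField.Normc.normcM pow_coef_rec.
apply: (le_trans (le_normcD _ _)); rewrite normcN lerD//.
apply: (le_trans (le_normcD _ _)); rewrite [leRHS]mulrDl lerD// ComplexField.Normc.normcM.
  by rewrite normcN ler_wpM2l ?normc_ge0// lerDl normc_ge0.
by rewrite ler_wpM2l ?normc_ge0// lerDr normc_ge0.
Qed.

(** u(s) = - 4 pi s k_A(s). *)
Definition kA_num s : R[i] := log_series a b s.

Lemma kA_cvg s :
  kA_partial Z kappa s @ \oo --> (- ((4 * pi * s)^-1)%:C * kA_num s : R[i]^o).
Proof.
have H := cvgM (cvg_cst (- ((4 * pi * s)^-1)%:C : R[i]^o))
  (cvgD (cvg_pseries_sumC (s := s) entireC_pow_coef)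
    (cvgM (cvg_pseries_sumC (s := s) entireC_log_coef) (cvg_cst ((ln s)%:C : R[i]^o)))).
suff -> : kA_partial Z kappa s = (fun n => - ((4 * pi * s)^-1)%:C *
   (series (fun n => a n * (s ^+ n)%:C) n + series (fun n => b n * (s ^+ n)%:C) n * (ln s)%:C)) by exact: H.
apply/funext => n; rewrite /kA_partial /series /= big_distrl -big_split big_distrr /=.
by apply: eq_bigr => p _; rewrite /kA_term kp_coefs; ring.
Qed.

Lemma kAE s : kA Z kappa s = - ((4 * pi * s)^-1)%:C * kA_num s.
Proof. exact: (@cvg_lim (R[i]^o) (@norm_hausdorff _ (R[i]^o)) nat \oo _ _ _ (@kA_cvg s)). Qed.

(** v = u - s u' = 4 pi s^2 k_A', the flux of the gradient of k_A through the
    sphere of radius s; the second series is s u'. *)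
Definition kA_flux s : R[i] :=
  kA_num s - log_series (fun n => n%:R * a n + b n) (fun n => n%:R * b n) s.

(* Coefficients of the flux, as a logarithmic series of its own. *)
Let fa n : R[i] := 1 * a n + (-1) * (n%:R * a n + b n).
Let fb n : R[i] := 1 * b n + (-1) * (n%:R * b n).

Let efa : entireC fa.
Proof.
apply: entireC_lin; first exact: entireC_pow_coef.
by apply: entireC_add; [apply: entireC_euler; exact: entireC_pow_coef|exact: entireC_log_coef].
Qed.

Let efb : entireC fb.
Proof. by apply: entireC_lin; [|apply: entireC_euler]; exact: entireC_log_coef. Qed.

Let kA_fluxE s : kA_flux s = log_series fa fb s.
Proof.
rewrite log_series_lin ?mul1r ?mulN1r//.
- exact: entireC_pow_coef.
- exact: entireC_log_coef.
- by apply: entireC_add; [apply: entireC_euler; exact: entireC_pow_coef|exact: entireC_log_coef].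
- by apply: entireC_euler; exact: entireC_log_coef.
Qed.

Let shiftup (c : nat -> R[i]) n : R[i] := if n is m.+1 then c m else 0.

(** The recurrences for the coefficients are the identity s v' = s (2Z - 2 kappa^2 s) u,
    read off power by power. *)
Lemma kA_flux_euler s :
  log_series (fun n => n%:R * fa n + fb n) (fun n => n%:R * fb n) s =
  s%:C * ((2 * Z - 2 * kappa ^+ 2 * s%:C) * kA_num s).
Proof.
have ea := entireC_pow_coef; have eb := entireC_log_coef.
have ea' : entireC (shiftup a) by apply: entireC_unshift.
have eb' : entireC (shiftup b) by apply: entireC_unshift.
rewrite log_series_shift; last 4 first.
- by apply: entireC_add => //; exact: entireC_euler.
- exact: entireC_euler.
- by rewrite mul0r add0r /fb log_coef0; ring.
- by rewrite mul0r.
congr (_ * _).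
have -> : (fun n => n.+1%:R * fa n.+1 + fb n.+1) =
   (fun n => 2 * Z * a n + - (2 * kappa ^+ 2) * shiftup a n).
  apply/funext => -[|n]; rewrite /fa /fb /=.
    by rewrite log_coef1 pow_coef0 pow_coef1; ring.
  have E : 2 * Z * a n.+1 + - (2 * kappa ^+ 2) * a n = - ((n.+2 * n.+1)%:R * a n.+2 + (2 * n + 3)%:R * b n.+2).
    by rewrite pow_coef_rec; ring.
  by rewrite E natrM natrD natrM -[n.+2%:R]natr1 -[n.+1%:R]natr1; ring.
have -> : (fun n => n.+1%:R * fb n.+1) =
   (fun n => 2 * Z * b n + - (2 * kappa ^+ 2) * shiftup b n).
  apply/funext => -[|n]; rewrite /fa /fb /=.
    by rewrite log_coef0 log_coef1; ring.
  have E : 2 * Z * b n.+1 + - (2 * kappa ^+ 2) * b n = - ((n.+2 * n.+1)%:R * b n.+2).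
    by rewrite log_coef_rec; ring.
  by rewrite E natrM -[n.+2%:R]natr1 -[n.+1%:R]natr1; ring.
rewrite log_series_lin// (log_series_shift (a := shiftup a))//= -/(kA_num s).
by ring.
Qed.

Lemma real_complexV (x : R) : (x^-1)%:C = (x%:C)^-1 :> R[i].
Proof. exact: fmorphV. Qed.

Lemma Re_realM (x : R) (z : R[i]) : complex.Re (x%:C * z) = x * complex.Re z.
Proof. by rewrite ReE /= mul0r subr0. Qed.

(** The radial form of A k_A = 0 away from the origin: (s^2 k_A')' is
    s^2 (2 kappa^2 - 2Z/s) k_A. *)
Lemma is_derive_kA_flux l s : 0 < s ->
  is_derive s 1 (fun t => complex.Re (l * kA_flux t))
   (4 * pi * s ^+ 2 * complex.Re (l * ((2 * kappa ^+ 2 - 2 * Z / s%:C) * kA Z kappa s))).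
Proof.
move=> s0; under eq_fun do rewrite kA_fluxE.
have := is_derive_Re_log_series l efa efb s0; congr is_derive.
rewrite kA_flux_euler kAE; apply: (mulIf (lt0r_neq0 s0)); rewrite divfK ?lt0r_neq0//.
rewrite [RHS]mulrAC -Re_realM; congr complex.Re.
have s1 : s%:C != 0 :> R[i] by rewrite eq_complex /= eqxx andbT lt0r_neq0.
have p1 : pi%:C != 0 :> R[i] by rewrite eq_complex /= eqxx andbT lt0r_neq0// pi_gt0.
rewrite real_complexV !(rmorphM, rmorphXn, rmorph_nat).
move: (pi : R) p1 => p p1.
by field; apply/andP.
Qed.

Lemma Re_kAE l s : complex.Re (l * kA Z kappa s) =
  - ((4 * pi)^-1) * (s^-1 * complex.Re (l * kA_num s)).
Proof.
rewrite kAE invfM (_ : l * _ = (- ((4 * pi)^-1 * s^-1))%:C * (l * kA_num s)).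
  by rewrite Re_realM; ring.
by rewrite rmorphN /=; ring.
Qed.

Lemma is_derive_kA l s : 0 < s ->
  is_derive s 1 (fun t => complex.Re (l * kA Z kappa t))
   (complex.Re (l * kA_flux s) / (4 * pi * s ^+ 2)).
Proof.
move=> s0.
have -> : (fun t => complex.Re (l * kA Z kappa t)) =
   (fun t => - ((4 * pi)^-1) * (t^-1 * complex.Re (l * kA_num t))).
  by apply/funext => t; rewrite Re_kAE.
have d1 := is_derive_Re_log_series l entireC_pow_coef entireC_log_coef s0.
have s1 := lt0r_neq0 s0.
have d2 : is_derive s 1 (fun t : R => t^-1) (- s ^- 2).
  by have := is_deriveV s1 (is_derive_id s (1 : R)); rewrite /GRing.scale /= mulr1.
have := is_deriveZ (- ((4 * pi)^-1)) (is_deriveM d2 d1).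
congr is_derive; rewrite /GRing.scale /= /kA_flux mulrBr raddfB /=.
have p1 : pi != 0 :> R by rewrite lt0r_neq0// pi_gt0.
move: (pi : R) p1 => p p1.
rewrite -/(kA_num s); field.
by rewrite p1 s1.
Qed.

Lemma Re_kA_num_bound l S : exists2 C, 0 <= C & forall s, 0 < s <= S ->
  `|complex.Re (l * kA_num s)| <= C.
Proof.
have [C C0 HC] := Re_log_series_estimate l S entireC_pow_coef entireC_log_coef (log_coef0 Z kappa).
exists (`|complex.Re (l * a 0%N)| + C * root4 S ^+ 3).
  by rewrite addr_ge0// mulr_ge0// exprn_ge0// root4_ge0.
move=> s s0S; rewrite -[complex.Re _](subrK (complex.Re (l * a 0%N))) addrC.
apply: (le_trans (ler_normD _ _)); rewrite lerD2l (le_trans (HC s s0S))//.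
rewrite ler_wpM2l//; apply: lerXn2r; rewrite ?nnegrE ?root4_ge0//.
by case/andP: s0S => _ sS; rewrite !ler_wsqrtr.
Qed.

Lemma kA_bound l S : exists2 C, 0 <= C & forall s, 0 < s <= S ->
  `|complex.Re (l * kA Z kappa s)| <= C / s.
Proof.
have [C C0 HC] := Re_kA_num_bound l S.
have p4 : 0 < 4 * pi :> R by rewrite mulr_gt0// pi_gt0.
exists ((4 * pi)^-1 * C); first by rewrite mulr_ge0// invr_ge0 ltW.
move=> s s0S; have s0 : 0 < s by case/andP: s0S.
rewrite Re_kAE normrM normrN normrM [`|(4 * pi)^-1|]gtr0_norm ?invr_gt0// [`|s^-1|]gtr0_norm ?invr_gt0//.
rewrite -mulrA ler_wpM2l ?invr_ge0 ?(ltW p4)//.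
by rewrite mulrC ler_wpM2r ?HC// invr_ge0 ltW.
Qed.

(** The flux tends to 1 at the origin; this limit is the mass of the delta. *)
Lemma kA_flux_estimate l S : exists2 C, 0 <= C & forall s, 0 < s <= S ->
  `|complex.Re (l * kA_flux s) - complex.Re l| <= C * root4 s ^+ 3.
Proof.
have [|C C0 HC] := Re_log_series_estimate l S efa efb.
  by rewrite /fb log_coef0; ring.
exists C => // s s0S; rewrite kA_fluxE; have := HC s s0S.
by have -> : fa 0 = 1 by [rewrite /fa pow_coef0 log_coef0; ring]; rewrite mulr1.
Qed.

End RadialSolution.

(** * Lebesgue measure on three-space *)

Section Triple.
Local Open Scope ereal_scope.
Context (d : measure_display) (T : measurableType d) (R : realType).
Variable m : {sigma_finite_measure set T -> \bar R}.

(** A name of its own for m \x m, so that it can carry the sigma-finiteness that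
    the theorems of Tonelli and Fubini ask of both factors. *)
Definition square_measure : set (T * T) -> \bar R := m \x m.

HB.instance Definition _ := Measure.on square_measure.

Let square_sigma_finite : sigma_finite setT square_measure.
Proof.
have /sigma_finiteP[F [TF ndF Foo]] := sigma_finiteT m.
exists (fun n => F n `*` F n).
  rewrite -setXTT TF predeqE => -[x y]; split.
    move=> [/= [n _ Fnx] [k _ Fky]]; exists (maxn n k) => //; split.
    - by move: x Fnx; exact/subsetPset/ndF/leq_maxl.
    - by move: y Fky; exact/subsetPset/ndF/leq_maxr.
  by move=> [n _ []/= ? ?]; split; exists n.
move=> k; have [? ?] := Foo k.
split; first exact: measurableX.
by rewrite /square_measure product_measure1E// lte_mul_pinfty// ge0_fin_numE.
Qed.

HB.instance Definition _ := Measure_isSigmaFinite.Build _ _ _ square_measure square_sigma_finite.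

Definition cube_measure : {measure set (T * T * T) -> \bar R} := square_measure \x m.

Lemma tonelli_cube (F : T * T * T -> \bar R) : measurable_fun setT F -> (forall x, 0 <= F x) ->
  \int[cube_measure]_x F x = \int[m]_x \int[m]_y \int[m]_z F (x, y, z).
Proof.
move=> mF F0.
transitivity (\int[square_measure]_p fubini_F m F p).
  exact: (@fubini_tonelli1 _ _ _ _ R square_measure m F mF F0).
have mF' : measurable_fun setT (fubini_F m F) by exact: measurable_fun_fubini_tonelli_F.
have F0' p : 0 <= fubini_F m F p by exact: integral_ge0.
exact: (@fubini_tonelli1 _ _ _ _ R m m (fubini_F m F) mF' F0').
Qed.

Lemma cube_measureE A B C : measurable A -> measurable B -> measurable C ->
  cube_measure (A `*` B `*` C) = m A * m B * m C.
Proof.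
move=> mA mB mC; transitivity (square_measure (A `*` B) * m C).
  by apply: product_measure1E => //; exact: measurableX.
by congr (_ * _); exact: product_measure1E.
Qed.

Definition line_point (i : 'I_3) (x y t : T) : T * T * T :=
  match val i with 0 => (t, x, y) | 1 => (x, t, y) | _ => (x, y, t) end.

(** Fubini's theorem, with the lines of direction i integrated first. For the first
    two directions the sections at fixed last coordinate are integrable only
    almost everywhere, which suffices. *)
Lemma integral_cube_lines0 (i : 'I_3) (F : T * T * T -> \bar R) :
  cube_measure.-integrable setT F ->
  (forall x y, \int[m]_t F (line_point i x y t) = 0) -> \int[cube_measure]_x F x = 0.
Proof.
case: i => -[|[|[|//]]] i3 iF; rewrite /line_point /= => H; last first.
  rewrite -(@integral12_prod_meas1 _ _ _ _ R square_measure m F iF).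
  by rewrite integral0_eq// => -[x y] _; exact: H.
all: rewrite -(@integral21_prod_meas1 _ _ _ _ R square_measure m F iF).
all: transitivity (\int[m]_z (cst 0 z : \bar R)); last by rewrite integral0.
all: apply: ae_eq_integral => //;
  first exact: (@measurable_fubini_G _ _ _ _ R square_measure m F iF).
all: have := @ae_integrable2 _ _ _ _ R square_measure m F iF; apply: filterS => z iz _;
  rewrite /fubini_G /=.
  rewrite -(@integral12_prod_meas1 _ _ _ _ R m m _ iz).
  by rewrite integral0_eq// => x _; exact: H.
rewrite -(@integral21_prod_meas1 _ _ _ _ R m m _ iz).
by rewrite integral0_eq// => y _; exact: H.
Qed.

End Triple.

Section Space3.
Variable R : realType.
Local Notation mR := (measurableTypeR R).
Local Notation R3 := (R * R * R)%type.
Local Notation mR3 := (mR * mR * mR)%type.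

(** The boxes with rational centre and radius 1/(n+1) are a countable base of the
    product topology. *)
Lemma open_measurable3 (U : set R3) : open U -> measurable (U : set mR3).
Proof.
move=> oU.
pose box (q : rat * rat * rat * nat) : set mR3 :=
  (ball (ratr q.1.1.1 : R) (q.2.+1%:R^-1 : R) `*` ball (ratr q.1.1.2 : R) (q.2.+1%:R^-1 : R))
     `*` ball (ratr q.1.2 : R) (q.2.+1%:R^-1 : R).
have mbox q : measurable (box q).
  apply: measurableX; [apply: measurableX|]; exact: measurable_ball.
have -> : U = \bigcup_(q in [set q | box q `<=` U]) box q.
  apply/seteqP; split => [x Ux|x [q qU]]; last exact: qU.
  have /nbhs_ballP[e /= e0 xeU] : nbhs x U by exact: open_nbhs_nbhs.
  pose n := Num.truncn (2 / e).
  have ne : (n.+1%:R^-1 : R) < e / 2.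
    by rewrite -[ltRHS]invf_div ltf_pV2 ?posrE ?divr_gt0// truncnS_gt.
  have dn : (0 : R) < n.+1%:R^-1 by rewrite invr_gt0.
  have rat_in (t : R) : exists q : rat, ball t (n.+1%:R^-1) (ratr q).
    have /rat_in_itvoo[q /itvP qt] : t - n.+1%:R^-1 < t + n.+1%:R^-1 :> R.
      by rewrite ltrBlDr -addrA ltrDl addr_gt0.
    by exists q; rewrite ball_itv /= in_itv /= !qt.
  have [q1 h1] := rat_in x.1.1; have [q2 h2] := rat_in x.1.2; have [q3 h3] := rat_in x.2.
  exists (q1, q2, q3, n); last first.
    by split; [split|]; apply: ball_sym.
  move=> y [[/= y1 y2] y3]; apply: xeU.
  have tri (u v w : R) : ball u n.+1%:R^-1 v -> ball v n.+1%:R^-1 w -> ball u e w.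
    by move=> uv vw; have := ball_triangle uv vw; apply: le_ball; rewrite (splitr e) lerD// ltW.
  by split; [split|]; [exact: tri h1 y1|exact: tri h2 y2|exact: tri h3 y3].
rewrite bigcup_mkcond; apply: countable_bigcupT_measurable => [|q]; first exact: countableP.
by case: ifP.
Qed.

Lemma closed_measurable3 (U : set R3) : closed U -> measurable (U : set mR3).
Proof.
by move=> cU; rewrite -[U]setCK; apply: measurableC; apply: open_measurable3; exact: closed_openC.
Qed.

Lemma continuous_measurable3 (f : R3 -> R) : continuous f -> measurable_fun [set: mR3] f.
Proof.
move=> /continuousP cf; apply: (measurability _ (RGenOpens.measurableE R)) => //.
move=> _ [_ [a [b ->] <-]]; rewrite setTI; apply: open_measurable3; apply: cf.
exact: interval_open.
Qed.

Local Notation mu := (@lebesgue_measure R).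
Local Open Scope ereal_scope.

Lemma leb3E : leb3 R = cube_measure mu. Proof. by []. Qed.

Definition box (M : R) : set mR3 := (`[(- M)%R, M] `*` `[(- M)%R, M] `*` `[(- M)%R, M])%classic.

Lemma measurable_box M : measurable (box M).
Proof. by apply: measurableX => //; apply: measurableX. Qed.

Lemma box_finite M : leb3 R (box M) < +oo.
Proof.
rewrite leb3E cube_measureE//= lebesgue_measure_itv.
by case: ifP => _; rewrite ?mul0e//= -?EFinD -?EFinM ltry.
Qed.

Lemma bounded_box_integrable (F : R3 -> R) C M : measurable_fun [set: mR3] F ->
  (forall x, (`|F x| <= C)%R) -> (forall x, ~ box M x -> F x = 0%R) ->
  (leb3 R).-integrable setT (EFin \o F).
Proof.
move=> mF FC F0.
have : (leb3 R).-integrable (box M) (EFin \o F).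
  apply: measurable_bounded_integrable; [exact: measurable_box|exact: box_finite| |].
    exact: measurable_funTS.
  by exists C; split; rewrite ?num_real// => D CD x _ /=; rewrite (le_trans (FC x))// ltW.
move/(integrable_mkcond _ (measurable_box M)); congr (_.-integrable _ _).
apply/funext => x /=; rewrite patchE; case: ifPn => //; rewrite notin_setE => xM /=.
by rewrite F0.
Qed.

(** On the coordinate planes the dominating function [dom3] is 0 instead of
    infinite, since 0^-1 = 0; being negligible, they can be discarded. *)
Lemma null_axis3 : (leb3 R).-negligible [set x : mR3 | x.1.1 = 0 \/ x.1.2 = 0 \/ x.2 = 0]%R.
Proof.
have H (A B C : set mR) : measurable A -> measurable B -> measurable C ->
    (mu A = 0 \/ mu B = 0 \/ mu C = 0) -> (leb3 R).-negligible (A `*` B `*` C).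
  move=> mA mB mC H; apply/negligibleP; first by apply: measurableX => //; exact: measurableX.
  transitivity (cube_measure mu (A `*` B `*` C)) => //; rewrite cube_measureE//.
  suff : mu A * mu B * mu C = 0 by [].
  by case: H => [|[]] ->; rewrite ?mul0e ?mule0 ?mul0e.
have S : ([set x : mR3 | x.1.1 = 0 \/ x.1.2 = 0 \/ x.2 = 0]%R `<=`
    [set 0%R] `*` setT `*` setT `|` (setT `*` [set 0%R] `*` setT `|`
      setT `*` setT `*` [set 0%R]))%classic.
  by move=> [[x y] z] /= [->|[->|->]]; [left|right;left|right;right].
apply: (negligibleS S).
by repeat apply: negligibleU; apply: H => //; rewrite lebesgue_measure_set1; tauto.
Qed.

End Space3.

(** * Integrals on the line *)

Section Line.
Variable R : realType.
Local Notation mu := (@lebesgue_measure R).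
Local Open Scope ereal_scope.

Lemma is_derive_continuous_at (g : R -> R) (s d : R) :
  is_derive s (1%R:R) g d -> {for s, continuous g}.
Proof.
by move=> H; apply: differentiable_continuous; apply/derivable1_diffP; have [] := H.
Qed.

Lemma derivable_continuous (f df : R -> R) :
  (forall x, is_derive x (1%R:R) f (df x)) -> continuous f.
Proof. by move=> H x; exact: is_derive_continuous_at (H x). Qed.

Lemma is_derive_ext (f g : R -> R) (x d e : R) : is_derive x (1%R:R) f d ->
  f =1 g -> d = e -> is_derive x (1%R:R) g e.
Proof. by move=> H /funext <- <-. Qed.

Lemma even_line_integral (f F : R -> R) (l : R) :
  (forall x, 0 <= f x)%R -> continuous f -> (forall x, f (- x) = f x)%R ->
  (forall x, is_derive x (1%R:R) F (f x)) -> F 0%R = 0%R -> F x @[x --> +oo%R] --> l ->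
  \int[mu]_x (f x)%:E = (2 * l)%:E.
Proof.
move=> f0 cf ef dF F0 Fl.
rewrite ge0_symfun_integralT//; last by move=> x /=; rewrite ef.
have cF := derivable_continuous dF.
have cw : {within `[0%R, +oo[, continuous f} by exact: continuous_subspaceT.
have dF' x : (0 < x)%R -> derivable F x 1 by move=> _; have [] := dF x.
have F0' : F x @[x --> 0^'+] --> F 0%R by apply: cvg_at_right_filter; exact: cF.
have Ff : {in `]0%R, +oo[, derive1 F =1 f}.
  by move=> x _; rewrite derive1E; apply: derive_val; exact: dF.
rewrite -set_itvcy (ge0_continuous_FTC2y _ cw Fl dF' F0' Ff)//.
by rewrite F0 sube0 EFinM.
Qed.

Local Open Scope ring_scope.
Definition hypot (b t : R) : R := Num.sqrt (t ^+ 2 + b).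

Lemma hypot_gt0 b t : 0 < b -> 0 < hypot b t.
Proof. by move=> b0; rewrite sqrtr_gt0 ltr_wpDl// sqr_ge0. Qed.

Lemma hypot_sqr b t : 0 < b -> hypot b t ^+ 2 = t ^+ 2 + b.
Proof. by move=> b0; rewrite sqr_sqrtr// ltW// ltr_wpDl// sqr_ge0. Qed.

Lemma hypotN b t : hypot b (- t) = hypot b t.
Proof. by rewrite /hypot sqrrN. Qed.

Lemma is_derive_hypot b t : 0 < b -> is_derive t (1%R:R) (hypot b) (t / hypot b t).
Proof.
move=> b0; have p : 0 < t ^+ 2 + b by rewrite ltr_wpDl// sqr_ge0.
have d1 := is_derive1_sqrt p.
have d2 : is_derive t (1%R:R) (fun t : R => t ^+ 2 + b) (2 * t).
  apply: (is_derive_ext (is_deriveD (is_deriveX 2 (is_derive_id t (1%R:R)))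
    (is_derive_cst b t (1%R:R)))) => //.
  by rewrite /GRing.scale /= addr0 expr1; ring.
have H := @is_derive1_comp R (@Num.sqrt R) (fun t : R => t ^+ 2 + b) t _ _ d1 d2.
apply: (is_derive_ext H) => //.
have := lt0r_neq0 (hypot_gt0 t b0); rewrite /hypot => h0.
by field.
Qed.

Lemma is_derive_hypotV b t : 0 < b -> is_derive t (1%R:R) (fun t => (hypot b t)^-1) (- t / hypot b t ^+ 3).
Proof.
move=> b0; have h0 := lt0r_neq0 (hypot_gt0 t b0).
apply: (is_derive_ext (is_deriveV h0 (is_derive_hypot t b0))) => //.
by rewrite /GRing.scale /=; field.
Qed.

Lemma continuous_hypotVn b n : 0 < b -> continuous (fun t => (hypot b t) ^- n).
Proof.
move=> b0.
have -> : (fun t => hypot b t ^- n) = (fun x : R => x ^+ n) \o (fun t => (hypot b t)^-1).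
  by apply/funext => t /=; rewrite exprVn.
move=> t; apply: continuous_comp; last exact: exprn_continuous.
exact: (derivable_continuous (fun t => is_derive_hypotV t b0)).
Qed.

Lemma hypotV_cvg0 b : 0 < b -> (hypot b t)^-1 @[t --> +oo] --> (0 : R).
Proof.
move=> b0; apply/(@gtr0_cvgV0 R R _ _ (fun t => hypot b t)).
  by near=> t; exact: hypot_gt0.
apply: (@ger_cvgy _ _ _ _ id) => //.
near=> t; rewrite -[leLHS]ger0_norm// -sqrtr_sqr ler_wsqrtr// lerDl ltW//.
Unshelve. all: by end_near. Qed.

Lemma hypot_ratio_cvg1 b : 0 < b -> t / hypot b t @[t --> +oo] --> (1 : R).
Proof.
move=> b0.
have H : (1 - b * ((hypot b t)^-1 * (hypot b t)^-1)) @[t --> +oo] --> (1 - b * (0 * 0) : R).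
  apply: cvgB; first exact: cvg_cst.
  by apply: cvgM; [exact: cvg_cst|apply: cvgM; exact: hypotV_cvg0].
rewrite mul0r mulr0 subr0 in H.
apply: (@squeeze_cvgr _ _ _ _ (fun t => 1 - b * ((hypot b t)^-1 * (hypot b t)^-1)) (cst 1)) => //; last exact: cvg_cst.
near=> t.
have t0 : 0 < t by near: t; exact: nbhs_pinfty_gt.
have h0 := hypot_gt0 t b0.
have -> : 1 - b * ((hypot b t)^-1 * (hypot b t)^-1) = (t / hypot b t) ^+ 2.
  have E := hypot_sqr t b0; move: (hypot b t) h0 E => h h0 E.
  have -> : b = h ^+ 2 - t ^+ 2 by rewrite E; ring.
  by field; exact: lt0r_neq0.
have le1 : t / hypot b t <= 1.
  rewrite ler_pdivrMr// mul1r -[leLHS]ger0_norm ?(ltW t0)// -sqrtr_sqr ler_wsqrtr//.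
  by rewrite lerDl ltW.
rewrite le1 andbT expr2 ler_piMr// divr_ge0// ltW//.
Unshelve. all: by end_near. Qed.

(** With h = sqrt (t^2 + b) one has (t/h)' = b/h^3 and ((t/h)^3)' = 3 b t^2/h^5, so
    (t/h - (t/h)^3/3)/b^2 is a primitive of h^(-5). *)
Lemma integral_hypot5 b : 0 < b ->
  (\int[mu]_t ((hypot b t) ^- 5)%:E = (2 * ((1 - 1 / 3) / b ^+ 2))%:E)%E.
Proof.
move=> b0.
apply: (@even_line_integral _ (fun t => (t / hypot b t - (t / hypot b t) ^+ 3 / 3) / b ^+ 2)).
- by move=> x; rewrite invr_ge0 exprn_ge0// ltW// hypot_gt0.
- exact: continuous_hypotVn.
- by move=> x; rewrite hypotN.
- move=> t; have h0 := lt0r_neq0 (hypot_gt0 t b0).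
  have d1 := is_deriveM (is_derive_id t (1%R:R)) (is_derive_hypotV t b0).
  apply: (is_derive_ext (is_deriveZ (b ^- 2) (is_deriveB d1 (is_deriveZ (3^-1) (is_deriveX 3 d1))))).
    move=> x; transitivity (b ^- 2 * (x / hypot b x - 3^-1 * (x / hypot b x) ^+ 3)); first by [].
    by ring.
  pose D := t * (- t / hypot b t ^+ 3) + (hypot b t)^-1 * 1.
  transitivity (b ^- 2 * (D - 3^-1 * (3 * (t / hypot b t) ^+ 2 * D))); first by [].
  rewrite {}/D.
  have E := hypot_sqr t b0; move: (hypot b t) h0 E => h h0 E.
  have b1 : h ^+ 2 - t ^+ 2 != 0 by rewrite E addrC addKr gt_eqF.
  have -> : b = h ^+ 2 - t ^+ 2 by rewrite E addrC addKr.
  by field; rewrite h0 b1.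
- by rewrite /= !mul0r expr0n /= mul0r subr0 mul0r.
- have H := hypot_ratio_cvg1 b0.
  apply: cvgM; last exact: cvg_cst.
  apply: cvgB => //; apply: cvgM; last exact: cvg_cst.
  rewrite -[X in _ --> X](expr1n _ 3).
  exact: (cvg_comp _ _ H (@exprn_continuous R 3 1)).
Qed.

Lemma integral_hypot3 b : 0 < b ->
  (\int[mu]_t ((hypot b t) ^- 3)%:E = (2 * b^-1)%:E)%E.
Proof.
move=> b0; apply: (@even_line_integral _ (fun t => (t / hypot b t) / b)).
- by move=> x; rewrite invr_ge0 exprn_ge0// ltW// hypot_gt0.
- exact: continuous_hypotVn.
- by move=> x; rewrite hypotN.
- move=> t; have h0 := lt0r_neq0 (hypot_gt0 t b0).
  have d1 := is_deriveM (is_derive_id t (1%R:R)) (is_derive_hypotV t b0).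
  apply: (is_derive_ext (is_deriveZ (b^-1) d1)).
    by move=> x; transitivity (b^-1 * (x / hypot b x)); [by []|ring].
  transitivity (b^-1 * (t * (- t / hypot b t ^+ 3) + (hypot b t)^-1 * 1)); first by [].
  have E := hypot_sqr t b0; move: (hypot b t) h0 E => h h0 E.
  have b1 : h ^+ 2 - t ^+ 2 != 0 by rewrite E addrC addKr gt_eqF.
  have -> : b = h ^+ 2 - t ^+ 2 by rewrite E addrC addKr.
  by field; rewrite h0 b1.
- by rewrite /= !mul0r.
- by rewrite -[X in _ --> X]mul1r; apply: cvgM; [exact: hypot_ratio_cvg1|exact: cvg_cst].
Qed.

Lemma cvgy_scale (d : R) : 0 < d -> t / d @[t --> +oo] --> +oo.
Proof.
move=> d0; apply/cvgryPge => A; near=> t.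
rewrite ler_pdivlMr//; near: t; exact: nbhs_pinfty_ge.
Unshelve. all: by end_near. Qed.

(** The parameter is a square because the primitive involves atan (t/d). *)
Lemma integral_hypot4 d : 0 < d ->
  (\int[mu]_t ((hypot (d ^+ 2) t) ^- 4)%:E = (2 * (pi / 2 / (2 * d ^+ 3)))%:E)%E.
Proof.
move=> d0; have b0 : 0 < d ^+ 2 by rewrite exprn_gt0.
have d1 := lt0r_neq0 d0.
apply: (@even_line_integral _ (fun t => (t / hypot (d ^+ 2) t) * (hypot (d ^+ 2) t)^-1 / (2 * d ^+ 2)
   + atan (t / d) / (2 * d ^+ 3))).
- by move=> x; rewrite invr_ge0 exprn_ge0// ltW// hypot_gt0.
- exact: continuous_hypotVn.
- by move=> x; rewrite hypotN.
- move=> t; have h0 := lt0r_neq0 (hypot_gt0 t b0).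
  have e1 := is_derive_hypotV t b0.
  have e2 := is_deriveM (is_deriveM (is_derive_id t (1%R:R)) e1) e1.
  have e3 : is_derive t (1%R:R) (fun t => t / d) d^-1.
    apply: (is_derive_ext (is_deriveZ d^-1 (is_derive_id t (1%R:R)))).
      by move=> x; transitivity (d^-1 * x); [by []|ring].
    by transitivity (d^-1 * 1); [by []|ring].
  have e4 := @is_derive1_comp R (@atan R) (fun t => t / d) t _ _ (is_derive1_atan _) e3.
  apply: (is_derive_ext (is_deriveD (is_deriveZ (2 * d ^+ 2)^-1 e2) (is_deriveZ (2 * d ^+ 3)^-1 e4))).
    move=> x; transitivity ((2 * d ^+ 2)^-1 * (x / hypot (d ^+ 2) x * (hypot (d ^+ 2) x)^-1) +
      (2 * d ^+ 3)^-1 * atan (x / d)); [by []|ring].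
  transitivity ((2 * d ^+ 2)^-1 * (t / hypot (d ^+ 2) t * (- t / hypot (d ^+ 2) t ^+ 3) +
     (hypot (d ^+ 2) t)^-1 * (t * (- t / hypot (d ^+ 2) t ^+ 3) + (hypot (d ^+ 2) t)^-1 * 1)) +
     (2 * d ^+ 3)^-1 * ((1 + (t / d) ^+ 2)^-1 * d^-1)); first by [].
  have E := hypot_sqr t b0; move: (hypot (d ^+ 2) t) h0 E => h h0 E.
  have -> : (1 + (t / d) ^+ 2)^-1 = d ^+ 2 / h ^+ 2.
    have p : t ^+ 2 + d ^+ 2 != 0 by rewrite -E expf_neq0.
    by rewrite E; field; rewrite d1 p.
  have -> : (2 * d ^+ 3)^-1 * (d ^+ 2 / h ^+ 2 * d^-1) = (2 * d ^+ 2)^-1 / h ^+ 2.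
    by field; rewrite d1 h0.
  have b1 : h ^+ 2 - t ^+ 2 != 0 by rewrite E addrC addKr gt_eqF.
  have -> : d ^+ 2 = h ^+ 2 - t ^+ 2 by rewrite E addrC addKr.
  by field; rewrite h0 b1.
- by rewrite /= !mul0r atan0 mul0r addr0.
- rewrite -[X in _ --> X]add0r; apply: cvgD.
    rewrite -(mul0r (2 * d ^+ 2)^-1); apply: cvgM; last exact: cvg_cst.
    rewrite -[X in _ --> X](mulr0 1); apply: cvgM; first exact: hypot_ratio_cvg1.
    exact: hypotV_cvg0.
  apply: cvgM; last exact: cvg_cst.
  exact: (@cvg_comp _ _ _ (fun t => t / d) (@atan R) _ _ _ (cvgy_scale d0) (@cvgy_atan R)).
Qed.

(** |t|^(-3/4) / (1 + |t|^(1/2)) is integrable both at 0 and at infinity: on t > 0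
    it has the bounded primitive 4 atan (t^(1/4)). *)
Definition dom1 (t : R) : R := (root4 `|t|) ^- 3 / (1 + root4 `|t| ^+ 2).

Lemma dom1_ge0 t : 0 <= dom1 t.
Proof. by rewrite divr_ge0// ?invr_ge0 ?addr_ge0// exprn_ge0// root4_ge0. Qed.

Lemma dom1N t : dom1 (- t) = dom1 t.
Proof. by rewrite /dom1 normrN. Qed.

Lemma continuous_root4 : continuous (@root4 R).
Proof.
move=> t; apply: (@continuous_comp _ _ _ (@Num.sqrt R) (@Num.sqrt R)); exact: sqrt_continuous.
Qed.

Lemma continuous_dom1 t : t != 0 -> {for t, continuous dom1}.
Proof.
move=> t0.
have c4 : {for t, continuous (fun t => root4 `|t|)}.
  apply: (@continuous_comp _ _ _ (fun t : R => `|t|) (@root4 R)); first exact: norm_continuous.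
  exact: continuous_root4.
have cn n : {for t, continuous (fun t => root4 `|t| ^+ n)}.
  by apply: (@continuous_comp _ _ _ (fun t => root4 `|t|) (fun x => x ^+ n)) => //; exact: exprn_continuous.
apply: (@continuousM _ _ (fun t => root4 `|t| ^- 3) (fun t => (1 + root4 `|t| ^+ 2)^-1)).
  apply: (@continuousV _ _ (fun t => root4 `|t| ^+ 3)) => //.
  by rewrite expf_neq0// lt0r_neq0// root4_gt0// normr_gt0.
apply: (@continuousV _ _ (fun t => 1 + root4 `|t| ^+ 2)).
  by rewrite lt0r_neq0// ltr_pwDl// exprn_ge0// root4_ge0.
by apply: cvgD; [exact: cvg_cst|exact: (cn 2%N)].
Qed.

Lemma measurable_continuous_off0 (f : R -> R) :
  (forall t, t != 0 -> {for t, continuous f}) -> measurable_fun [set: measurableTypeR R] f.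
Proof.
move=> cf; rewrite -(setvU [set 0%R]); apply/measurable_funU => //; first exact: measurableC.
split; last exact: measurable_fun_set1.
apply: open_continuous_measurable_fun.
  by apply: closed_openC; apply: accessible_closed_set1; apply: hausdorff_accessible; exact: Rhausdorff.
by move=> t; rewrite inE /= => /eqP; exact: cf.
Qed.

Lemma measurable_dom1 : measurable_fun [set: measurableTypeR R] dom1.
Proof. by apply: measurable_continuous_off0; exact: continuous_dom1. Qed.

Lemma is_derive_root4 (t : R) : 0 < t -> is_derive t (1%R:R) (@root4 R) ((4 * root4 t ^+ 3)^-1).
Proof.
move=> t0; have s0 : 0 < Num.sqrt t by rewrite sqrtr_gt0.
apply: (is_derive_ext (@is_derive1_comp R (@Num.sqrt R) (@Num.sqrt R) t _ _
  (is_derive1_sqrt s0) (is_derive1_sqrt t0))) => //.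
have E : Num.sqrt t = root4 t ^+ 2 by rewrite sqr_sqrtr// sqrtr_ge0.
rewrite -/(root4 t) E; have r0 := lt0r_neq0 (root4_gt0 t0).
by field.
Qed.

Lemma root4_cvgy : @root4 R t @[t --> +oo] --> +oo.
Proof.
apply/cvgryPge => A; near=> t.
have t0 : 0 <= t by near: t; exact: nbhs_pinfty_ge.
have tA : `|A| ^+ 4 <= t by near: t; apply: nbhs_pinfty_ge; rewrite num_real.
rewrite (le_trans (ler_norm A))// -(@ler_pXn2r _ 4)// ?nnegrE ?root4_ge0//.
by rewrite root4K.
Unshelve. all: by end_near. Qed.

Lemma integral_dom1_tail a : 0 < a ->
  (\int[mu]_(t in `[a, +oo[) (dom1 t)%:E <= (4 * pi)%:E)%E.
Proof.
move=> a0.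
have cd t : a <= t -> {for t, continuous dom1}.
  by move=> at0; apply: continuous_dom1; rewrite lt0r_neq0// (lt_le_trans a0).
have dF (t : R) : 0 < t -> is_derive t (1%R:R) (fun t => 4 * atan (root4 t)) (dom1 t).
  move=> t0.
  have H := @is_derive1_comp R (@atan R) (@root4 R) t _ _ (is_derive1_atan _) (is_derive_root4 t0).
  apply: (is_derive_ext (is_deriveZ 4 H)) => //.
  transitivity (4 * ((1 + root4 t ^+ 2)^-1 * (4 * root4 t ^+ 3)^-1)); first by [].
  rewrite /dom1 gtr0_norm//; have r0 := root4_gt0 t0.
  field; rewrite (lt0r_neq0 r0) /= lt0r_neq0// ltr_pwDl// exprn_ge0// ltW//.
have cw : {within `[a, +oo[, continuous dom1}.
  apply/continuous_within_itvcyP; split.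
    by move=> t; rewrite in_itv /= andbT => /ltW; exact: cd.
  by apply: cvg_at_right_filter; apply: cd.
have Fl : (4 * atan (root4 t)) @[t --> +oo] --> (4 * (pi / 2) : R).
  apply: cvgM; first exact: cvg_cst.
  exact: (@cvg_comp _ _ _ (@root4 R) (@atan R) _ _ _ root4_cvgy (@cvgy_atan R)).
have dF' x : (a < x)%R -> derivable (fun t => 4 * atan (root4 t)) x 1.
  by move=> ax; have [] := dF x (lt_trans a0 ax).
have F0' : (4 * atan (root4 x)) @[x --> a^'+] --> 4 * atan (root4 a).
  apply: cvg_at_right_filter.
  apply: (@differentiable_continuous _ _ _ a (fun x => 4 * atan (root4 x))).
  by apply/derivable1_diffP; have [] := dF a a0.
have Ff : {in `]a, +oo[, derive1 (fun t => 4 * atan (root4 t)) =1 dom1}.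
  move=> x; rewrite in_itv /= andbT => ax; rewrite derive1E; apply: derive_val.
  by apply: dF; exact: lt_trans ax.
rewrite (ge0_continuous_FTC2y _ cw Fl dF' F0' Ff)//; last by move=> x _; exact: dom1_ge0.
rewrite -EFinB lee_fin.
by have := atan_gtNpi2 (root4 a); lra.
Qed.

(** The sets |t| >= 1/(n+1) exhaust the line up to the origin. *)
Lemma integral_dom1_fin : (\int[mu]_t (dom1 t)%:E < +oo)%E.
Proof.
pose F n := [set` `]-oo, (- (n.+1%:R^-1))%R]] `|` [set` `[n.+1%:R^-1, +oo[] : set R.
have mE : measurable_fun setT (EFin \o dom1) by apply/measurable_EFinP; exact: measurable_dom1.
have F0 n : 0 < n.+1%:R^-1 :> R by rewrite invr_gt0.
have cd n t : n.+1%:R^-1 <= `|t| -> {for t, continuous dom1}.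
  by move=> nt; apply: continuous_dom1; rewrite -normr_gt0 (lt_le_trans (F0 n)).
have HF n : (\int[mu]_(t in F n) (dom1 t)%:E <= (8 * pi)%:E)%E.
  rewrite ge0_integral_setU//=; last 3 first.
  - exact: measurable_funTS.
  - by move=> t _; rewrite lee_fin dom1_ge0.
  - apply/disj_setPS => t /=; rewrite !in_itv /= andbT => -[h1 h2].
    by have := le_trans h2 h1; rewrite leNgt gtrN// F0.
  rewrite (_ : 8 * pi = 4 * pi + 4 * pi); last by ring.
  rewrite EFinD leeD//; last exact: integral_dom1_tail.
  rewrite ge0_integration_by_substitutionNy.
  - under eq_integral do rewrite /= dom1N.
    exact: integral_dom1_tail.
  - apply/continuous_within_itvNycP; split.
      move=> t; rewrite in_itv /= => /ltW tn; apply: (cd n).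
      by rewrite lerNr in tn; rewrite (le_trans tn)// -normrN ler_norm.
    by apply: cvg_at_left_filter; apply: (cd n); rewrite normrN ler_norm.
  - by move=> t _; exact: dom1_ge0.
have UF : \bigcup_n F n = ~` [set 0].
  apply/seteqP; split => [t [n _]|t /eqP t0].
    by rewrite /F /= !in_itv /= andbT => -[] h t0; move: h; rewrite t0 ?oppr_ge0 leNgt F0.
  pose n := Num.truncn (`|t|^-1).
  have nt : n.+1%:R^-1 <= `|t|.
    have p : 0 < `|t| by rewrite normr_gt0.
    by rewrite -[leRHS]invrK lef_pV2 ?posrE ?invr_gt0// ltW// truncnS_gt.
  exists n => //; rewrite /F /= !in_itv /= andbT.
  have [t1|t1] := leP 0 t; first by right; rewrite -(ger0_norm t1).
  by left; rewrite lerNr -(ltr0_norm t1).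
have mF n : measurable (F n : set (measurableTypeR R)) by apply: measurableU.
have nF : nondecreasing_seq F.
  move=> n p np; apply/subsetPset => t; rewrite /F /= !in_itv /= !andbT.
  have pn : p.+1%:R^-1 <= n.+1%:R^-1 :> R by rewrite lef_pV2 ?posrE// ler_nat.
  by move=> [h|h]; [left; rewrite (le_trans h)// lerN2|right; rewrite (le_trans pn)].
have cF : (\int[mu]_(t in F n) (dom1 t)%:E @[n --> \oo] --> \int[mu]_(t in \bigcup_n F n) (dom1 t)%:E)%E.
  apply: ge0_nondecreasing_set_cvg_integral => //.
  - by move=> n; exact: measurable_funTS.
  - by move=> n x _; rewrite lee_fin dom1_ge0.
have H : (\int[mu]_(t in \bigcup_n F n) (dom1 t)%:E <= (8 * pi)%:E)%E.
  rewrite -(cvg_lim _ cF)//; apply: lime_le; first by apply/cvg_ex; eexists; exact: cF.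
  exact: nearW.
apply: le_lt_trans (ltry (8 * pi)).
rewrite -(@integral_setD1 _ _ 0) //; last 2 first.
  - exact: measurableD.
  - exact: measurable_funTS.
by rewrite setTD -UF.
Qed.

End Line.

(** * Radial functions on three-space *)

Section Radial.
Variable R : realType.
Local Notation mR := (measurableTypeR R).
Local Notation R3 := (R * R * R)%type.
Local Notation mR3 := (mR * mR * mR)%type.
Local Notation mu := (@lebesgue_measure R).
Implicit Types x : R3.

Lemma euclid_ge0 x : 0 <= euclid x. Proof. exact: sqrtr_ge0. Qed.

Lemma euclid_sqr x : euclid x ^+ 2 = x.1.1 ^+ 2 + x.1.2 ^+ 2 + x.2 ^+ 2.
Proof. by rewrite sqr_sqrtr// !addr_ge0// sqr_ge0. Qed.

Lemma continuous_euclid : continuous (@euclid R).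
Proof.
move=> x; apply: (@continuous_comp _ _ _ (fun x : R3 => x.1.1 ^+ 2 + x.1.2 ^+ 2 + x.2 ^+ 2) (@Num.sqrt R)); last exact: sqrt_continuous.
have c11 : {for x, continuous (fun x : R3 => x.1.1)}.
  by apply: (@continuous_comp _ _ _ (fun x : R3 => x.1) fst); exact: cvg_fst.
have c12 : {for x, continuous (fun x : R3 => x.1.2)}.
  by apply: (@continuous_comp _ _ _ (fun x : R3 => x.1) snd); [exact: cvg_fst|exact: cvg_snd].
have c2 : {for x, continuous (fun x : R3 => x.2)} by exact: cvg_snd.
apply: cvgD; [apply: cvgD|]; rewrite /=.
- by under eq_fun do rewrite expr2; rewrite expr2; exact: cvgM.
- by under eq_fun do rewrite expr2; rewrite expr2; exact: cvgM.
- by under eq_fun do rewrite expr2; rewrite expr2; exact: cvgM.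
Qed.

Lemma coord_le_euclid x : [/\ `|x.1.1| <= euclid x, `|x.1.2| <= euclid x & `|x.2| <= euclid x].
Proof.
have s0 := sqr_ge0 x.1.1; have s1 := sqr_ge0 x.1.2; have s2 := sqr_ge0 x.2.
by split; rewrite -sqrtr_sqr ler_wsqrtr//; lra.
Qed.

(** The regularized distance sqrt (r^2 + e) to the origin. *)
Definition radius (e : R) x : R := hypot e (euclid x).

Lemma radius_gt0 e x : 0 < e -> 0 < radius e x.
Proof. exact: hypot_gt0. Qed.

Lemma radius_sqr e x : 0 < e -> radius e x ^+ 2 = euclid x ^+ 2 + e.
Proof. exact: hypot_sqr. Qed.

Lemma euclid_le_radius e x : 0 <= e -> euclid x <= radius e x.
Proof.
move=> e0; rewrite -[leLHS]ger0_norm ?euclid_ge0// -sqrtr_sqr ler_wsqrtr//.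
by rewrite lerDl.
Qed.

Lemma radius_le e x : 0 <= e <= 1 -> radius e x <= euclid x + 1.
Proof.
move=> /andP[e0 e1]; rewrite -[leRHS]ger0_norm ?addr_ge0 ?euclid_ge0// -sqrtr_sqr ler_wsqrtr//.
have := euclid_ge0 x; nra.
Qed.

Lemma continuous_hypot e : 0 < e -> continuous (@hypot R e).
Proof. by move=> e0; apply: derivable_continuous => t; exact: is_derive_hypot. Qed.

Lemma continuous_radius e : 0 < e -> continuous (radius e).
Proof.
move=> e0 x; apply: (@continuous_comp _ _ _ (@euclid R) (hypot e)); first exact: continuous_euclid.
exact: continuous_hypot.
Qed.

Lemma measurable_euclid : measurable_fun [set: mR3] (@euclid R).
Proof. by apply: continuous_measurable3; exact: continuous_euclid. Qed.

Lemma measurable_radial (g : R -> R) : (forall s, 0 < s -> {for s, continuous g}) ->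
  measurable_fun [set: mR3] (fun x : mR3 => g (euclid x)).
Proof.
move=> cg.
have -> : (fun x : mR3 => g (euclid x)) = (fun s => g `|s|) \o (@euclid R).
  by apply/funext => x /=; rewrite ger0_norm// euclid_ge0.
apply: measurableT_comp; last exact: measurable_euclid.
apply: measurable_continuous_off0 => t t0.
apply: (@continuous_comp _ _ _ (fun s : R => `|s|) g); first exact: norm_continuous.
by apply: cg; rewrite normr_gt0.
Qed.

Lemma continuous_radial (g : R -> R) e : 0 < e -> (forall s, 0 < s -> {for s, continuous g}) ->
  continuous (fun x : R3 => g (radius e x)).
Proof.
move=> e0 cg x; apply: (@continuous_comp _ _ _ (radius e) g); first exact: continuous_radius.
by apply: cg; exact: radius_gt0.
Qed.

Lemma cvg_radius (x : R3) : radius ((n.+1%:R^-1) ^+ 2) x @[n --> \oo] --> euclid x.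
Proof.
apply: squeeze_cvgr; last 2 first.
- exact: cvg_cst.
- rewrite -[X in _ --> X]addr0; apply: cvgD; first exact: cvg_cst.
  exact: cvg_harmonic.
near=> n; rewrite euclid_le_radius ?sqr_ge0//=.
have h0 : 0 <= (n.+1%:R^-1 : R) by rewrite invr_ge0.
rewrite -[leRHS]ger0_norm ?addr_ge0 ?euclid_ge0// -sqrtr_sqr ler_wsqrtr//.
rewrite -[leRHS]/((euclid x + n.+1%:R^-1) ^+ 2).
by have := euclid_ge0 x; move: (n.+1%:R^-1) (euclid x) h0 => h r h0 r0; nra.
Unshelve. all: by end_near. Qed.

Local Open Scope ereal_scope.

(** Integrating out one coordinate at a time replaces the power -5 by -4, then by
    -3, each time of the same expression with one variable less. *)
Lemma integral_radius5 e : (0 < e)%R ->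
  \int[leb3 R]_x ((radius e x) ^- 5)%:E = (4 * pi / (3 * e))%:E.
Proof.
move=> e0; rewrite leb3E (@tonelli_cube _ _ R mu (fun x : mR3 => ((radius e x) ^- 5)%:E)); last 2 first.
- apply/measurable_EFinP; apply: (@continuous_measurable3 _ (fun x : mR3 => radius e x ^- 5)).
  apply: (@continuous_radial (fun s => s ^- 5)%R) => // s s0.
  apply: cvgV; first by rewrite expf_neq0// lt0r_neq0.
  exact: exprn_continuous.
- by move=> x; rewrite lee_fin invr_ge0 exprn_ge0// ltW// radius_gt0.
have Ez (x y : R) : \int[mu]_z ((radius e (x, y, z)) ^- 5)%:E =
    (4 / 3)%:E * (hypot (hypot e x ^+ 2) y ^- 4)%:E.
  have b0 : (0 < x ^+ 2 + y ^+ 2 + e)%R by rewrite ltr_wpDl// addr_ge0// sqr_ge0.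
  transitivity (\int[mu]_z (hypot (x ^+ 2 + y ^+ 2 + e) z ^- 5)%:E).
    apply: eq_integral => z _; congr ((_ ^- 5)%:E).
    by rewrite /radius /hypot euclid_sqr /=; congr Num.sqrt; ring.
  rewrite integral_hypot5// -EFinM; congr (_%:E).
  have h1 : (hypot (hypot e x ^+ 2) y ^+ 2 = x ^+ 2 + y ^+ 2 + e)%R.
    by rewrite hypot_sqr ?exprn_gt0 ?hypot_gt0// hypot_sqr//; ring.
  rewrite -h1 in b0 *; have h0 : hypot (hypot e x ^+ 2) y != 0%R.
    by apply: contraTneq b0 => ->; rewrite expr0n ltxx.
  by field.
have Ey (x : R) : \int[mu]_y \int[mu]_z ((radius e (x, y, z)) ^- 5)%:E =
    (2 * pi / 3)%:E * (hypot e x ^- 3)%:E.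
  under eq_integral do rewrite Ez.
  have d0 := hypot_gt0 x e0.
  rewrite ge0_integralZl_EFin//; last 2 first.
  - by move=> y _; rewrite lee_fin invr_ge0 exprn_ge0// ltW// hypot_gt0// exprn_gt0.
  - apply/measurable_EFinP; apply: continuous_measurable_fun; apply: continuous_hypotVn.
    by rewrite exprn_gt0.
  rewrite integral_hypot4// -!EFinM; congr (_%:E).
  by move: (pi : R) => p; field; exact: lt0r_neq0.
under eq_integral do rewrite Ey.
rewrite ge0_integralZl_EFin//; last 3 first.
- by move=> y _; rewrite lee_fin invr_ge0 exprn_ge0// ltW// hypot_gt0.
- by apply/measurable_EFinP; apply: continuous_measurable_fun; exact: continuous_hypotVn.
- by rewrite divr_ge0// mulr_ge0// pi_ge0.
rewrite integral_hypot3// -EFinM; congr (_%:E).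
by move: (pi : R) => p; field; exact: lt0r_neq0.
Qed.

(** Integrable because it is a product. As each coordinate is at most s in absolute
    value when r <= s, it dominates the cube of [dom1 s], which behaves like
    s^(-9/4) at 0: this replaces integration in polar coordinates. *)
Definition dom3 x : R := (dom1 x.1.1 * dom1 x.1.2 * dom1 x.2)%R.

Lemma dom3_ge0 x : (0 <= dom3 x)%R.
Proof. by apply: mulr_ge0; [apply: mulr_ge0|]; exact: dom1_ge0. Qed.

Lemma measurable_dom3 : measurable_fun [set: mR3] dom3.
Proof.
apply: measurable_funM; [apply: measurable_funM|].
- by apply: (measurableT_comp (@measurable_dom1 R)); apply: (measurableT_comp measurable_fst); exact: measurable_fst.
- by apply: (measurableT_comp (@measurable_dom1 R)); apply: (measurableT_comp measurable_snd); exact: measurable_fst.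
- by apply: (measurableT_comp (@measurable_dom1 R)); exact: measurable_snd.
Qed.

Lemma integrable_dom3 : (leb3 R).-integrable setT (EFin \o dom3).
Proof.
have mD : measurable_fun [set: mR3] (EFin \o dom3) by apply/measurable_EFinP; exact: measurable_dom3.
have m1 : measurable_fun [set: mR] (EFin \o @dom1 R) by apply/measurable_EFinP; exact: measurable_dom1.
apply/integrableP; split=> //.
under eq_integral do rewrite /= ger0_norm ?dom3_ge0//.
rewrite leb3E (@tonelli_cube _ _ R mu (EFin \o dom3))//; last by move=> x; rewrite lee_fin dom3_ge0.
have [I IE] : exists I : R, \int[mu]_t (dom1 t)%:E = I%:E.
  have := integral_dom1_fin R.
  have : 0 <= \int[mu]_t (dom1 t)%:E by apply: integral_ge0 => t _; rewrite lee_fin dom1_ge0.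
  by case: (\int[mu]_t _) => // I _ _; exists I.
have I0 : (0 <= I)%R by rewrite -lee_fin -IE integral_ge0// => t _; rewrite lee_fin dom1_ge0.
have H (c : R) : (0 <= c)%R -> \int[mu]_t (c * dom1 t)%:E = (c * I)%:E.
  move=> c0; under eq_integral do rewrite EFinM.
  by rewrite ge0_integralZl_EFin// ?IE ?EFinM// => t _; rewrite lee_fin dom1_ge0.
have Ez (x y : R) : \int[mu]_z (dom3 (x, y, z))%:E = (I * dom1 x * dom1 y)%:E.
  by rewrite /dom3 /= H; [congr (_%:E); ring|apply: mulr_ge0; exact: dom1_ge0].
have Ey (x : R) : \int[mu]_y \int[mu]_z (dom3 (x, y, z))%:E = (I * I * dom1 x)%:E.
  under eq_integral do rewrite Ez.
  by rewrite H; [congr (_%:E); ring|apply: mulr_ge0 => //; exact: dom1_ge0].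
under eq_integral do rewrite Ey.
by rewrite H ?ltry// mulr_ge0.
Qed.

End Radial.

(** * Dominated convergence and Green's formula *)

Section Green.
Variable R : realType.
Local Notation mR := (measurableTypeR R).
Local Notation R3 := (R * R * R)%type.
Local Notation mR3 := (mR * mR * mR)%type.
Local Notation mu := (@lebesgue_measure R).
Implicit Types x : R3.

Definition off_axes x : Prop := [/\ x.1.1 != 0, x.1.2 != 0 & x.2 != 0].

Lemma ae_off_axes (P : R3 -> Prop) : (forall x, off_axes x -> P x) ->
  {ae leb3 R, forall x : mR3, P x}.
Proof.
move=> H; apply: (negligibleS _ (null_axis3 R)) => x /= nP.
apply: contrapT => /not_orP[/eqP h1 /not_orP[/eqP h2 /eqP h3]]; apply: nP; exact: H.
Qed.

Lemma integrable_dom3_scaled (C : R) :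
  (leb3 R).-integrable setT (EFin \o (fun x : mR3 => C * dom3 x)).
Proof.
have := @integrableZl _ _ _ (leb3 R) setT measurableT C _ (integrable_dom3 R).
exact: eq_integrable.
Qed.

Lemma integrable3_dominated (F : R3 -> R) (C : R) :
  measurable_fun [set: mR3] F ->
  (forall x, off_axes x -> `|F x| <= C * dom3 x) ->
  (leb3 R).-integrable setT (EFin \o F).
Proof.
move=> mF FC; apply/integrableP; split; first exact/measurable_EFinP.
have iC := integrable_dom3_scaled C.
have /integrableP[mC] := iC; apply: le_lt_trans.
apply: ae_ge0_le_integral => //.
- by apply: measurableT_comp => //; exact/measurable_EFinP.
- exact: measurableT_comp.
- apply: ae_off_axes => x ox _ /=; rewrite lee_fin (le_trans (FC x ox))// ler_norm//.
Qed.

Lemma cvg_Rintegral3 (F_ : nat -> R3 -> R) (F : R3 -> R) (C : R) :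
  (forall n, measurable_fun [set: mR3] (F_ n)) -> measurable_fun [set: mR3] F ->
  (forall n x, off_axes x -> `|F_ n x| <= C * dom3 x) ->
  (forall x, off_axes x -> F_ n x @[n --> \oo] --> F x) ->
  (leb3 R).-integrable setT (EFin \o F) /\
  \int[leb3 R]_x F_ n x @[n --> \oo] --> \int[leb3 R]_x F x.
Proof.
move=> mF_ mF FC cF.
have iC := integrable_dom3_scaled C.
have [||||iF _ H] := @dominated_convergence _ _ _ (leb3 R) setT measurableT
   (fun n => EFin \o F_ n) (EFin \o F) _ _ _ _ iC.
- by move=> n; exact/measurable_EFinP.
- exact/measurable_EFinP.
- apply: ae_off_axes => x ox _; apply: cvg_EFin; first exact: nearW.
  exact: cF.
- by apply: ae_off_axes => x ox n _ /=; rewrite lee_fin FC.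
split=> //.
apply: fine_cvg; rewrite /Rintegral fineK; last exact: integrable_fin_num.
exact: H.
Qed.

Definition coord (i : 'I_3) x : R := match val i with 0 => x.1.1 | 1 => x.1.2 | _ => x.2 end.

Lemma continuous_coord i : continuous (coord i).
Proof.
move=> x; case: i => -[|[|k]] ki; rewrite /coord /=.
- by apply: (@continuous_comp _ _ _ (fun x : R3 => x.1) fst); [exact: cvg_fst|exact: cvg_fst].
- by apply: (@continuous_comp _ _ _ (fun x : R3 => x.1) snd); [exact: cvg_fst|exact: cvg_snd].
- exact: cvg_snd.
Qed.

Lemma boxP (M : R) x : box M x <-> forall i, `|coord i x| <= M.
Proof.
rewrite /box /=; split=> [[[]]|H].
  by rewrite !in_itv /= -!ler_norml => h1 h2 h3 [[|[|k]] ki]; rewrite /coord.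
have h0 := H (@Ordinal 3 0 isT); have h1 := H (@Ordinal 3 1 isT); have h2 := H (@Ordinal 3 2 isT).
by rewrite !in_itv /= -!ler_norml.
Qed.

Definition supported (M : R) (f : R3 -> R) : Prop := forall x, ~ box M x -> f x = 0.

Lemma supported_partial M f i : supported M f -> supported M (partial i f).
Proof.
move=> Sf x nx.
have [j Mj] : exists j, M < `|coord j x|.
  apply: contrapT => /forallNP H; apply: nx; apply/boxP => j.
  by rewrite leNgt; apply/negP; exact: H.
rewrite /partial (@near_eq_derive _ _ _ f (cst 0)); first exact: derive_cst.
have : \forall y \near x, M < `|coord j y|.
  have cj : `|coord j y| @[y --> x] --> `|coord j x|.
    by apply: cvg_norm; exact: continuous_coord.
  by apply: (cvgr_gt _ cj).
apply: filterS => y My; apply: Sf => /boxP /(_ j).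
by rewrite leNgt My.
Qed.

Lemma coord_line i (a b t : R) : coord i (line_point i a b t) = t.
Proof. by case: i => -[|[|[|//]]] ki. Qed.

Lemma euclid_line i (a b t : R) : euclid (line_point i a b t) ^+ 2 = t ^+ 2 + (a ^+ 2 + b ^+ 2).
Proof. by case: i => -[|[|[|//]]] ki; rewrite euclid_sqr /=; ring. Qed.

Lemma line_point_shift i (a b t h : R) :
  line_point i a b (h *: 1 + t) = h *: basis3 R i + line_point i a b t.
Proof.
case: i => -[|[|[|//]]] ki; rewrite /line_point /basis3 /=.
all: by congr (_, _, _); rewrite /= ?scaler0 ?add0r.
Qed.

Lemma is_derive_line f i (a b t : R) : derivable f (line_point i a b t) (basis3 R i) ->
  is_derive t (1:R) (fun t => f (line_point i a b t)) (partial i f (line_point i a b t)).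
Proof.
move=> df.
have E : (fun h : R => h^-1 *: (((fun t => f (line_point i a b t)) \o shift t) (h *: 1) - f (line_point i a b t)))
   = (fun h : R => h^-1 *: ((f \o shift (line_point i a b t)) (h *: basis3 R i) - f (line_point i a b t))).
  by apply/funext => h /=; rewrite line_point_shift.
split; first by rewrite /derivable E.
by rewrite /derive E.
Qed.

Lemma continuous_pair (T U V : topologicalType) (f : T -> U) (g : T -> V) :
  continuous f -> continuous g -> continuous (fun t => (f t, g t)).
Proof. by move=> cf cg t; exact: (cvg_pair (cf t) (cg t)). Qed.

Lemma continuous_line i (a b : R) : continuous (line_point i a b : R -> R3).
Proof.
have cc (c : R) : continuous (fun _ : R => c) by move=> ?; exact: cvg_cst.
have ci : continuous (fun t : R => t) by move=> ?.
case: i => -[|[|[|//]]] ki; rewrite /line_point /=.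
- exact: (continuous_pair (continuous_pair ci (cc a)) (cc b)).
- exact: (continuous_pair (continuous_pair (cc a) ci) (cc b)).
- exact: (continuous_pair (continuous_pair (cc a) (cc b)) ci).
Qed.

Section RadialProfile.
Variables (K K1 K2 : R -> R) (e : R).
Hypothesis e0 : 0 < e.
(* For s = radius e x, whose derivative in direction i is x_i / s, this says that
   K (s) and K1 (s) have the derivatives x_i K1 (s) and x_i K2 (s). *)
Hypothesis dK : forall s : R, 0 < s -> is_derive s (1:R) K (s * K1 s).
Hypothesis dK1 : forall s : R, 0 < s -> is_derive s (1:R) K1 (s * K2 s).
Hypothesis cK2 : forall s, 0 < s -> {for s, continuous K2}.
Variables (f : R3 -> R) (M : R).
Hypothesis sf : smooth f.
Hypothesis Sf : supported M f.

Let cf : continuous f. Proof. exact: (sf [::]).1. Qed.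
Let cf1 i : continuous (partial i f). Proof. exact: (sf [:: i]).1. Qed.
Let cf2 i : continuous (partial i (partial i f)). Proof. exact: (sf [:: i; i]).1. Qed.
Let df i x : derivable f x (basis3 R i). Proof. exact: (sf [::]).2. Qed.
Let df1 i x : derivable (partial i f) x (basis3 R i). Proof. exact: (sf [:: i]).2. Qed.

Let cK (s : R) : 0 < s -> {for s, continuous K}.
Proof. by move=> /dK; exact: is_derive_continuous_at. Qed.
Let cK1 (s : R) : 0 < s -> {for s, continuous K1}.
Proof. by move=> /dK1; exact: is_derive_continuous_at. Qed.

Definition green1 i x : R := partial i (partial i f) x * K (radius e x).
(** f times d_i d_i (K (s)), by the product rule applied to x_i K1 (s). *)
Definition green2 i x : R := f x * (K1 (radius e x) + coord i x ^+ 2 * K2 (radius e x)).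

Lemma continuous_green1 i : continuous (green1 i).
Proof.
move=> x; apply: cvgM; first exact: cf2.
exact: (continuous_radial e0 cK).
Qed.

Lemma continuous_green2 i : continuous (green2 i).
Proof.
move=> x; apply: cvgM; first exact: cf.
apply: cvgD; first exact: (continuous_radial e0 cK1).
apply: cvgM; last exact: (continuous_radial e0 cK2).
apply: (@continuous_comp _ _ _ (coord i) (fun t => t ^+ 2)); first exact: continuous_coord.
exact: exprn_continuous.
Qed.

Lemma supported_green1 i : supported M (green1 i).
Proof. by move=> x nx; rewrite /green1 (supported_partial i (supported_partial i Sf))// mul0r. Qed.

Lemma supported_green2 i : supported M (green2 i).
Proof. by move=> x nx; rewrite /green2 Sf// mul0r. Qed.

Lemma compact_box : compact (box M : set R3).
Proof. by apply: compact_setX; [apply: compact_setX|]; exact: segment_compact. Qed.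

Lemma supported_bounded (g : R3 -> R) : continuous g -> supported M g ->
  exists2 C, 0 <= C & forall x, `|g x| <= C.
Proof.
move=> cg Sg.
have cw : {within (box M : set R3), continuous g} by exact: continuous_subspaceT.
have /compact_bounded[B [_ HB]] := continuous_compact cw compact_box.
exists (`|B| + 1); first by rewrite addr_ge0.
move=> x; have [bx|nx] := pselect (box M x); last by rewrite Sg// normr0 addr_ge0.
apply: (HB (`|B| + 1)); last by exists x.
by rewrite (le_lt_trans (ler_norm B))// ltrDl.
Qed.

Lemma supported_integrable (g : R3 -> R) : continuous g -> supported M g ->
  (leb3 R).-integrable setT (EFin \o g).
Proof.
move=> cg Sg; have [C C0 HC] := supported_bounded cg Sg.
exact: (bounded_box_integrable (continuous_measurable3 cg) HC Sg).
Qed.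

(** On a line of direction i the integrand is the derivative of
    (d_i f) K - f t K1, which vanishes outside the support of f. *)
Lemma green_line i (a b : R) :
  (\int[mu]_t (green1 i (line_point i a b t) - green2 i (line_point i a b t))%:E = 0)%E.
Proof.
pose l := line_point i a b : R -> R3.
pose c := a ^+ 2 + b ^+ 2 + e.
have c0 : 0 < c by rewrite /c ltr_wpDl// addr_ge0// sqr_ge0.
have rl t : radius e (l t) = hypot c t.
  by rewrite /radius /hypot euclid_line /c; congr Num.sqrt; ring.
pose H t := partial i f (l t) * K (hypot c t) - f (l t) * (t * K1 (hypot c t)).
pose G t := green1 i (l t) - green2 i (l t).
have dH (t : R) : is_derive t (1:R) H (G t).
  have h0 := hypot_gt0 t c0.
  have dh := is_derive_hypot t c0.
  have d1 := is_derive_line (@df1 i (l t)).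
  have d0 := is_derive_line (@df i (l t)).
  have k0 := @is_derive1_comp R K (hypot c) t _ _ (dK h0) dh.
  have k1 := @is_derive1_comp R K1 (hypot c) t _ _ (dK1 h0) dh.
  have k2 := is_deriveM (is_derive_id t (1:R)) k1.
  apply: (is_derive_ext (is_deriveB (is_deriveM d1 k0) (is_deriveM d0 k2))) => //.
  rewrite /G /green1 /green2 rl coord_line.
  transitivity (partial i f (l t) * (hypot c t * K1 (hypot c t) * (t / hypot c t)) +
     K (hypot c t) * partial i (partial i f) (l t) -
     (f (l t) * (t * (hypot c t * K2 (hypot c t) * (t / hypot c t)) + K1 (hypot c t) * 1) +
      t * K1 (hypot c t) * partial i f (l t))); first by [].
  by field; exact: lt0r_neq0.
have cG : continuous G.
  move=> t; apply: (@continuous_comp _ _ _ l (fun x => green1 i x - green2 i x)).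
    exact: continuous_line.
  by apply: cvgB; [exact: continuous_green1|exact: continuous_green2].
have out t : M < `|t| -> ~ box M (l t).
  by move=> Mt /boxP /(_ i); rewrite coord_line leNgt Mt.
pose A := `|M| + 1.
have MA : M < A by rewrite /A (le_lt_trans (ler_norm M))// ltrDl.
have A0 : 0 < A by rewrite /A ltr_wpDl.
have H0 t : `|t| = A -> H t = 0.
  move=> tA; have nt : ~ box M (l t) by apply: out; rewrite tA.
  by rewrite /H (supported_partial i Sf)// Sf// !mul0r subrr.
have -> : (\int[mu]_t (G t)%:E = \int[mu]_(t in `[(- A)%R, A]) (G t)%:E)%E.
  rewrite [RHS]integral_mkcond; apply: eq_integral => t _; rewrite patchE.
  case: ifPn => // /negP; rewrite inE /= in_itv /= => /negP; rewrite -ler_norml -ltNge => tA.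
  have nt : ~ box M (l t) by apply: out; exact: lt_trans tA.
  by rewrite /G supported_green1// supported_green2// subrr.
have AA : - A < A by rewrite gtrN.
rewrite (@continuous_FTC2 _ G H (- A) A AA).
- by rewrite !H0 ?normrN ?gtr0_norm// subee.
- exact: continuous_subspaceT.
- have cH := derivable_continuous dH; split => [x _||].
  + by have [] := dH x.
  + by apply: cvg_at_right_filter; exact: cH.
  + by apply: cvg_at_left_filter; exact: cH.
- by move=> x _; rewrite derive1E; apply: derive_val; exact: dH.
Qed.

Lemma green_partial i :
  \int[leb3 R]_x green1 i x = \int[leb3 R]_x green2 i x.
Proof.
have i1 := supported_integrable (@continuous_green1 i) (@supported_green1 i).
have i2 := supported_integrable (@continuous_green2 i) (@supported_green2 i).
apply/eqP; rewrite -subr_eq0 -RintegralB//; apply/eqP; rewrite /Rintegral leb3E.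
have := @integral_cube_lines0 _ _ R mu i (fun x => (green1 i x - green2 i x)%:E).
move=> -> //.
- exact: (integrableB measurableT i1 i2).
- by move=> a b; exact: green_line.
Qed.

Lemma green :
  \int[leb3 R]_x (laplacian f x * K (radius e x)) =
  \int[leb3 R]_x (f x * (3 * K1 (radius e x) + euclid x ^+ 2 * K2 (radius e x))).
Proof.
have i1 i := supported_integrable (@continuous_green1 i) (@supported_green1 i).
have i2 i := supported_integrable (@continuous_green2 i) (@supported_green2 i).
have S3 (g : 'I_3 -> R3 -> R) : (forall i, (leb3 R).-integrable setT (EFin \o g i)) ->
   \int[leb3 R]_x (\sum_(i < 3) g i x) = \sum_(i < 3) \int[leb3 R]_x g i x.
  move=> ig; under eq_Rintegral do rewrite !big_ord_recl big_ord0 addr0.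
  rewrite !big_ord_recl big_ord0 addr0 !RintegralD//.
  exact: (integrableD measurableT (ig _) (ig _)).
transitivity (\int[leb3 R]_x (\sum_(i < 3) green1 i x)).
  by apply: eq_Rintegral => x _; rewrite /laplacian big_distrl.
rewrite S3// (eq_bigr (fun i => \int[leb3 R]_x green2 i x)); last by move=> i _; exact: green_partial.
rewrite -S3//; apply: eq_Rintegral => x _.
by rewrite !big_ord_recl big_ord0 addr0 /green2 /coord /= euclid_sqr; ring.
Qed.

End RadialProfile.

End Green.

(** * Pointwise domination *)

Section Domination.
Variable R : realType.
Local Notation mR := (measurableTypeR R).
Local Notation R3 := (R * R * R)%type.
Local Notation mR3 := (mR * mR * mR)%type.
Implicit Types x : R3.

Lemma le_root4 (s t : R) : s <= t -> root4 s <= root4 t.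
Proof. by move=> st; rewrite !ler_wsqrtr. Qed.

Lemma dom1_decr (s t : R) : 0 < t -> t <= s -> dom1 s <= dom1 t.
Proof.
move=> t0 ts; have s0 := lt_le_trans t0 ts; rewrite /dom1 !gtr0_norm//.
have r0 := root4_gt0 t0; have r1 := root4_gt0 s0; have rts := le_root4 ts.
move: (root4 s) (root4 t) r0 r1 rts => b a a0 b0 ab.
have p3 : a ^+ 3 <= b ^+ 3 by apply: lerXn2r; rewrite ?nnegrE// ltW.
have p2 : a ^+ 2 <= b ^+ 2 by apply: lerXn2r; rewrite ?nnegrE// ltW.
have q3 := exprn_gt0 3 a0; have q2 := exprn_gt0 2 a0.
have q3' := exprn_gt0 3 b0; have q2' := exprn_gt0 2 b0.
have a1 : 0 < 1 + a ^+ 2 by rewrite addr_gt0.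
have b1 : 0 < 1 + b ^+ 2 by rewrite addr_gt0.
have h1 : b ^- 3 <= a ^- 3 by rewrite lef_pV2.
have h2 : (1 + b ^+ 2)^-1 <= (1 + a ^+ 2)^-1 by rewrite lef_pV2// lerD2l.
by apply: ler_pM => //; rewrite invr_ge0 ltW.
Qed.

Lemma off_axes_euclid x : off_axes x -> 0 < euclid x.
Proof. by move=> [x0 _ _]; have [h _ _] := coord_le_euclid x; rewrite (lt_le_trans _ h)// normr_gt0. Qed.

Lemma dom1_norm (t : R) : dom1 `|t| = dom1 t.
Proof. by rewrite /dom1 normr_id. Qed.

Lemma dom3_radial x s : off_axes x -> euclid x <= s -> dom1 s ^+ 3 <= dom3 x.
Proof.
move=> [x0 x1 x2] xs; have [h0 h1 h2] := coord_le_euclid x.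
have H t : t != 0 -> `|t| <= euclid x -> dom1 s <= dom1 t.
  by move=> t0 te; rewrite -(dom1_norm t) dom1_decr// ?normr_gt0// (le_trans te).
have d0 := dom1_ge0 s.
have e0 := H _ x0 h0; have e1 := H _ x1 h1; have e2 := H _ x2 h2.
rewrite /dom3 !exprS expr0 mulr1 mulrA.
have d2 : 0 <= dom1 s * dom1 s by apply: mulr_ge0.
have e01 : dom1 s * dom1 s <= dom1 x.1.1 * dom1 x.1.2 by apply: ler_pM.
by apply: ler_pM.
Qed.

Lemma dom1_cube (s : R) : 0 < s ->
  dom1 s ^+ 3 = (root4 s ^+ 9 * (1 + root4 s ^+ 2) ^+ 3)^-1.
Proof.
move=> s0; rewrite /dom1 gtr0_norm//; have := root4_gt0 s0.
move: (root4 s) => a a0; have a1 := lt0r_neq0 a0.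
have a2 : 1 + a ^+ 2 != 0 by rewrite lt0r_neq0// ltr_pwDl// exprn_ge0// ltW.
by field; rewrite a1 a2.
Qed.

Lemma inv_sqr_dominated (S : R) : exists2 C, 0 <= C & forall s, 0 < s <= S ->
  s ^- 2 <= C * dom1 s ^+ 3.
Proof.
exists (root4 S * (1 + root4 S ^+ 2) ^+ 3).
  by rewrite mulr_ge0 ?root4_ge0// exprn_ge0// addr_ge0// exprn_ge0// root4_ge0.
move=> s /andP[s0 sS]; rewrite dom1_cube//.
have r0 := root4_gt0 s0; have rS := le_root4 sS.
have -> : s ^- 2 = root4 s ^- 8 by rewrite (exprM _ 4 2) root4K// ltW.
move: (root4 s) (root4 S) r0 rS => t T t0 tT.
have T0 := lt_le_trans t0 tT.
rewrite ler_pdivlMr; last by rewrite mulr_gt0 ?exprn_gt0// ltr_pwDl// exprn_ge0// ltW.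
rewrite (exprS t 8) mulrA [t ^- 8 * _]mulrCA mulVf ?lt0r_neq0 ?exprn_gt0// mulr1.
have t1 : 0 <= 1 + t ^+ 2 by rewrite addr_ge0// exprn_ge0// ltW.
have tT2 : t ^+ 2 <= T ^+ 2 by apply: lerXn2r; rewrite ?nnegrE// ltW.
have T1 : 1 + t ^+ 2 <= 1 + T ^+ 2 by rewrite lerD2l.
have h3 : (1 + t ^+ 2) ^+ 3 <= (1 + T ^+ 2) ^+ 3.
  by apply: lerXn2r; rewrite ?nnegrE// (le_trans t1).
by apply: ler_pM => //; rewrite ?exprn_ge0// ltW.
Qed.

(** The left side is e s^(-17/4). Near 0 the bound e <= s^2 makes it s^(-9/4), and at
    infinity e <= 1 suffices. *)
Lemma peak_dominated (e s : R) : 0 < s -> 0 <= e -> e <= 1 -> e <= s ^+ 2 ->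
  e * s ^- 5 * root4 s ^+ 3 <= 8 * dom1 s ^+ 3.
Proof.
move=> s0 e0 e1 es; rewrite dom1_cube//.
have r0 := root4_gt0 s0.
move: es; rewrite -[s in s ^+ 2](root4K (ltW s0)) -[s in s ^- 5](root4K (ltW s0)) -!exprM.
move: (root4 s) r0 => t t0 es.
have t20 : t ^+ 20 = t ^+ 3 * t ^+ 9 * t ^+ 8 by rewrite -!exprD.
rewrite ler_pdivlMr; last by rewrite mulr_gt0 ?exprn_gt0// ltr_pwDl// exprn_ge0// ltW.
have -> : e * t ^- (4 * 5) * t ^+ 3 * (t ^+ 9 * (1 + t ^+ 2) ^+ 3) = e * (1 + t ^+ 2) ^+ 3 / t ^+ 8.
  by rewrite t20; field; exact: lt0r_neq0.
rewrite ler_pdivrMr ?exprn_gt0//.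
have q0 : 0 <= (1 + t ^+ 2) ^+ 3 by rewrite exprn_ge0// addr_ge0// exprn_ge0// ltW.
have t1 : 0 <= 1 + t ^+ 2 by rewrite addr_ge0// exprn_ge0// ltW.
have [tle1|/ltW tge1] := leP t 1.
  have h : (1 + t ^+ 2) ^+ 3 <= 8.
    rewrite (_ : 8 = 2 ^+ 3); last by rewrite -natrX.
    apply: lerXn2r; rewrite ?nnegrE//.
    by rewrite -[leRHS]/(1 + 1) lerD2l exprn_ile1// ltW.
  by rewrite mulrC; apply: ler_pM.
have h : (1 + t ^+ 2) ^+ 3 <= (2 * t ^+ 2) ^+ 3.
  have t2 : 0 <= 2 * t ^+ 2 by rewrite mulr_ge0// exprn_ge0// ltW.
  apply: lerXn2r; rewrite ?nnegrE//.
  by rewrite mulr_natl mulr2n lerD2r exprn_ege1.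
apply: (@le_trans _ _ (1 * (2 * t ^+ 2) ^+ 3)); first by apply: ler_pM.
by rewrite mul1r exprMn -natrX -exprM ler_wpM2l// ler_weXn2l.
Qed.

End Domination.

(** * The Laplacian of a radial function and its flux at the origin *)

Section Limit.
Variable R : realType.
Local Notation mR := (measurableTypeR R).
Local Notation R3 := (R * R * R)%type.
Local Notation mR3 := (mR * mR * mR)%type.
Implicit Types x : R3.

Lemma line_lipschitz (f : R3 -> R) (i : 'I_3) (a b t B : R) :
  (forall x, derivable f x (basis3 R i)) -> (forall x, `|partial i f x| <= B) ->
  `|f (line_point i a b t) - f (line_point i a b 0)| <= B * `|t|.
Proof.
move=> df HB.
pose g s := f (line_point i a b s).
have dg (s : R) : is_derive s (1:R) g (partial i f (line_point i a b s)).
  by apply: is_derive_line; exact: df.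
have cg := derivable_continuous dg.
have M (u w : R) : u <= w -> `|g w - g u| <= B * (w - u).
  move=> uw; have [|c _ ->] := @MVT_segment R g (fun s => partial i f (line_point i a b s)) u w uw (fun s _ => dg s).
    exact: continuous_subspaceT.
  by rewrite normrM (ger0_norm (x := w - u)) ?subr_ge0// ler_wpM2r// subr_ge0.
have [t0|/ltW t0] := leP 0 t.
  by have := M 0 t t0; rewrite subr0 [`|t|]ger0_norm.

by have := M t 0 t0; rewrite sub0r distrC [`|t|]ler0_norm.
Qed.

(** The mean value theorem on a path from 0 to x made of three segments parallel to
    the axes. *)
Lemma euclid_lipschitz (f : R3 -> R) (B : R) : 0 <= B ->
  (forall i x, derivable f x (basis3 R i)) -> (forall i x, `|partial i f x| <= B) ->
  forall x, `|f x - f 0| <= 3 * B * euclid x.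
Proof.
move=> B0 df HB [[x1 x2] x3].
have [h1 h2 h3] := coord_le_euclid (x1, x2, x3); rewrite /= in h1 h2 h3.
have l1 := @line_lipschitz f (@Ordinal 3 0 isT) x2 x3 x1 B (df _) (HB _).
have l2 := @line_lipschitz f (@Ordinal 3 1 isT) 0 x3 x2 B (df _) (HB _).
have l3 := @line_lipschitz f (@Ordinal 3 2 isT) 0 0 x3 B (df _) (HB _).
rewrite /line_point /= in l1 l2 l3.
have -> : f (x1, x2, x3) - f 0 = (f (x1, x2, x3) - f (0, x2, x3)) +
   (f (0, x2, x3) - f (0, 0, x3)) + (f (0, 0, x3) - f (0, 0, 0)).
  by transitivity (f (x1, x2, x3) - f (0, 0, 0)); [by []|ring].
have -> : 3 * B * euclid (x1, x2, x3) = B * euclid (x1, x2, x3) + B * euclid (x1, x2, x3) + B * euclid (x1, x2, x3) by ring.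
apply: (le_trans (ler_normD _ _)); apply: lerD.
  apply: (le_trans (ler_normD _ _)); apply: lerD.
    by rewrite (le_trans l1)// ler_wpM2l.
  by rewrite (le_trans l2)// ler_wpM2l.
by rewrite (le_trans l3)// ler_wpM2l.
Qed.

Lemma euclid_le_box (M : R) x : 0 <= M -> box M x -> euclid x <= 2 * M.
Proof.
move=> M0 /boxP H.
have h0 := H (@Ordinal 3 0 isT); have h1 := H (@Ordinal 3 1 isT); have h2 := H (@Ordinal 3 2 isT).
rewrite /coord /= in h0 h1 h2.
rewrite -[leRHS]ger0_norm ?mulr_ge0// -sqrtr_sqr ler_wsqrtr//.
have sq (t : R) : `|t| <= M -> t ^+ 2 <= M ^+ 2.
  by move=> tM; rewrite -(real_normK (num_real t)); apply: lerXn2r; rewrite ?nnegrE.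
have := sq _ h0; have := sq _ h1; have := sq _ h2; rewrite exprMn -natrX.
have := sqr_ge0 M; lra.
Qed.

Lemma not_box_euclid (M : R) x : ~ box M x -> M <= euclid x.
Proof.
move=> nb; have [h0 h1 h2] := coord_le_euclid x.
apply: contrapT => /negP; rewrite -ltNge => xM; apply: nb; apply/boxP.
by move=> [[|[|k]] ki]; rewrite /coord /=; apply: ltW; apply: le_lt_trans xM.
Qed.

Variables (k v q : R -> R) (v0 : R).
Hypothesis dk : forall s : R, 0 < s -> is_derive s (1:R) k (v s / (4 * pi * s ^+ 2)).
Hypothesis dv : forall s : R, 0 < s -> is_derive s (1:R) v (4 * pi * s ^+ 2 * q s).
Hypothesis cq : forall s : R, 0 < s -> {for s, continuous q}.
Hypothesis bk : forall S, exists2 C, 0 <= C & forall s, 0 < s <= S -> `|k s| <= C / s.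
Hypothesis bq : forall S, exists2 C, 0 <= C & forall s, 0 < s <= S -> `|q s| <= C / s ^+ 2.
Hypothesis bv : forall S, exists2 C, 0 <= C & forall s, 0 < s <= S ->
  `|v s - v0| <= C * root4 s ^+ 3.

Let pi0 : 0 < pi :> R := pi_gt0 R.

Let ck (s : R) : 0 < s -> {for s, continuous k}.
Proof. by move=> /dk; exact: is_derive_continuous_at. Qed.
Let cv (s : R) : 0 < s -> {for s, continuous v}.
Proof. by move=> /dv; exact: is_derive_continuous_at. Qed.

(* K1 = k'/s and K2 = K1'/s, as Green's formula requires. *)
Let K1 (s : R) : R := v s / (4 * pi * s ^+ 3).
Let K2 (s : R) : R := q s / s ^+ 2 - 3 * v s / (4 * pi * s ^+ 5).

Let cVn n (s : R) : 0 < s -> {for s, continuous (fun s : R => s ^- n)}.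
Proof.
move=> s0; apply: cvgV; first by rewrite expf_neq0// lt0r_neq0.
exact: exprn_continuous.
Qed.

Let dK (s : R) : 0 < s -> is_derive s (1:R) k (s * K1 s).
Proof.
move=> s0; apply: (is_derive_ext (dk s0)) => //.
by rewrite /K1; move: (pi : R) pi0 => p p0; field; rewrite !lt0r_neq0.
Qed.

Let dK1 (s : R) : 0 < s -> is_derive s (1:R) K1 (s * K2 s).
Proof.
move=> s0.
have d3 : is_derive s (1:R) (fun s : R => (s^-1) ^+ 3) (- 3 * s ^- 4).
  have dV := is_deriveV (lt0r_neq0 s0) (is_derive_id s (1:R)).
  apply: (is_derive_ext (is_deriveX 3 dV)) => //.
  transitivity (3 * s^-1 ^+ 2 * (- s ^- 2 * 1)); first by [].
  by field; exact: lt0r_neq0.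
apply: (is_derive_ext (is_deriveZ (4 * pi)^-1 (is_deriveM (dv s0) d3))).
  move=> t; transitivity ((4 * pi)^-1 * (v t * t^-1 ^+ 3)); first by [].
  by rewrite /K1 (invfM (4 * pi)) exprVn; ring.
transitivity ((4 * pi)^-1 * (v s * (- 3 * s ^- 4) + s^-1 ^+ 3 * (4 * pi * s ^+ 2 * q s))); first by [].
by rewrite /K2; move: (pi : R) pi0 => p p0; field; rewrite !lt0r_neq0.
Qed.

Let cK2 (s : R) : 0 < s -> {for s, continuous K2}.
Proof.
move=> s0; apply: cvgB.
  by apply: cvgM; [exact: cq|exact: cVn].
apply: cvgM; first by apply: cvgM; [exact: cvg_cst|exact: cv].
apply: cvgV; first by rewrite mulf_neq0 ?expf_neq0 ?lt0r_neq0// mulr_gt0.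
by apply: cvgM; [exact: cvg_cst|exact: exprn_continuous].
Qed.

Variables (f : R3 -> R) (M : R).
Hypothesis M0 : 0 < M.
Hypothesis sf : smooth f.
Hypothesis Sf : supported M f.

Let cf : continuous f. Proof. exact: (sf [::]).1. Qed.
Let cf1 i : continuous (partial i f). Proof. exact: (sf [:: i]).1. Qed.
Let df i x : derivable f x (basis3 R i). Proof. exact: (sf [::]).2. Qed.

Let cf2 i : continuous (partial i (partial i f)). Proof. exact: (sf [:: i; i]).1. Qed.

Lemma continuous_add (g h : R3 -> R) : continuous g -> continuous h ->
  continuous (fun x => g x + h x).
Proof. by move=> cg ch x; exact: (cvgD (cg x) (ch x)). Qed.

Lemma continuous_laplacian : continuous (laplacian f).
Proof.
have sum_cont (g : 'I_3 -> R3 -> R) : (forall i, continuous (g i)) ->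
    continuous (fun x => \sum_(i < 3) g i x).
  move=> cg.
  have -> : (fun x => \sum_(i < 3) g i x) =
     (fun x => g ord0 x + (g (lift ord0 ord0) x + g (lift ord0 (lift ord0 ord0)) x)).
    by apply/funext => x; rewrite !big_ord_recl big_ord0 addr0.
  exact: (continuous_add (cg _) (continuous_add (cg _) (cg _))).
exact: sum_cont cf2.
Qed.

Lemma supported_laplacian : supported M (laplacian f).
Proof.
move=> x nx; rewrite /laplacian big1// => i _.
exact: (supported_partial i (supported_partial i Sf)).
Qed.

Let e (n : nat) : R := (n.+1%:R^-1) ^+ 2.
Let e_gt0 n : 0 < e n. Proof. by rewrite exprn_gt0// invr_gt0. Qed.
Let e_le1 n : e n <= 1.
Proof. by rewrite exprn_ile1// ?invr_ge0// invf_le1// ler1n. Qed.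

Let S : R := 2 * M + 1.
Let rad_gt0 n x : 0 < radius (e n) x. Proof. exact: radius_gt0. Qed.
Let rad_in n x : box M x -> 0 < radius (e n) x <= S.
Proof.
move=> bx; rewrite rad_gt0/= (le_trans (radius_le x _)) ?(ltW (e_gt0 n)) ?e_le1//.
by rewrite lerD2r euclid_le_box// ltW.
Qed.

Let e_le_rad n x : e n <= radius (e n) x ^+ 2.
Proof. by rewrite radius_sqr// lerDr sqr_ge0. Qed.

(* With s = radius (e n) x one has 3 K1 + r^2 K2 = q (1 - e/s^2) + 3 e v/(4 pi s^5),
   so Green's formula reads int T1 = int T2 + int T3 + v0 f(0): the kernel
   3 e/(4 pi s^5) has integral 1 and T3 is its action on f v - v0 f(0). *)
Let T1 n x := laplacian f x * k (radius (e n) x).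
Let T2 n x := f x * (q (radius (e n) x) * (1 - e n * radius (e n) x ^- 2)).
Let T3 n x := (3 * e n / (4 * pi)) * (radius (e n) x ^- 5 * (f x * v (radius (e n) x) - v0 * f 0)).

Let sqr_dom : exists2 C, 0 <= C & forall n x, off_axes x -> box M x ->
  radius (e n) x ^- 2 <= C * dom3 x.
Proof.
have [C C0 HC] := inv_sqr_dominated S; exists C => // n x ox bx.
apply: (le_trans (HC _ (rad_in n bx))); rewrite ler_wpM2l//.
by apply: dom3_radial => //; apply: euclid_le_radius; exact: ltW.
Qed.

Let T1_dom : exists C, forall n x, off_axes x -> `|T1 n x| <= C * dom3 x.
Proof.
have [A A0 HA] := supported_bounded continuous_laplacian supported_laplacian.
have [B B0 HB] := bk S; have [C C0 HC] := sqr_dom.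
have S0 : 0 <= S by rewrite addr_ge0// mulr_ge0// ltW.
exists (A * (B * S * C)) => n x ox.
have [bx|nx] := pselect (box M x); last first.
  by rewrite /T1 supported_laplacian// mul0r normr0 mulr_ge0 ?dom3_ge0// !mulr_ge0.
have /andP[s0 sS] := rad_in n bx.
rewrite /T1 normrM -[leRHS]mulrA; apply: ler_pM => //.
rewrite (le_trans (HB _ (rad_in n bx)))// -!mulrA ler_wpM2l//.
apply: (@le_trans _ _ (S * radius (e n) x ^- 2)); last by rewrite ler_wpM2l// HC.
have -> : (radius (e n) x)^-1 = radius (e n) x * radius (e n) x ^- 2.
  by field; exact: lt0r_neq0.
by rewrite ler_wpM2r// invr_ge0 exprn_ge0// ltW.
Qed.

Let T2_dom : exists C, forall n x, off_axes x -> `|T2 n x| <= C * dom3 x.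
Proof.
have [A A0 HA] := supported_bounded cf Sf.
have [B B0 HB] := bq S; have [C C0 HC] := sqr_dom.
exists (A * (B * C)) => n x ox.
have [bx|nx] := pselect (box M x); last first.
  by rewrite /T2 Sf// mul0r normr0 mulr_ge0 ?dom3_ge0// !mulr_ge0.
have /andP[s0 sS] := rad_in n bx.
rewrite /T2 !normrM -[leRHS]mulrA; apply: ler_pM => //.
have h1 : `|1 - e n * radius (e n) x ^- 2| <= 1.
  have s2 : 0 < radius (e n) x ^+ 2 by rewrite exprn_gt0.
  have a0 : 0 <= e n * radius (e n) x ^- 2 by rewrite mulr_ge0 ?invr_ge0 ?ltW.
  have a1 : e n * radius (e n) x ^- 2 <= 1 by rewrite ler_pdivrMr// mul1r e_le_rad.
  by rewrite ger0_norm ?subr_ge0// gerBl.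
apply: (@le_trans _ _ (B / radius (e n) x ^+ 2 * 1)).
  by apply: ler_pM => //; exact: HB (rad_in n bx).
by rewrite mulr1 -mulrA ler_wpM2l// HC.
Qed.

(** On the box, f v - v0 f(0) = f (v - v0) + v0 (f - f(0)) is O(s^(3/4)); outside it
    only the constant v0 f(0) is left, and s is bounded below. *)
Let flux_error : exists2 D, 0 <= D & forall n x,
  `|f x * v (radius (e n) x) - v0 * f 0| <= D * root4 (radius (e n) x) ^+ 3.
Proof.
have [A A0 HA] := supported_bounded cf Sf.
have [B B0 HB] : exists2 B, 0 <= B & forall i x, `|partial i f x| <= B.
  have HB i := supported_bounded (@cf1 i) (supported_partial i Sf).
  have [B0 B00 HB0] := HB ord0.
  have [B1 B10 HB1] := HB (lift ord0 ord0).
  have [B2 B20 HB2] := HB (lift ord0 (lift ord0 ord0)).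
  exists (B0 + B1 + B2); first by rewrite !addr_ge0.
  move=> i x; have [->|->|->] : [\/ i = ord0, i = lift ord0 ord0 | i = lift ord0 (lift ord0 ord0)].
  - case: i => -[|[|[|//]]] ki; [constructor 1|constructor 2|constructor 3]; exact: val_inj.
  - by rewrite (le_trans (HB0 x))// -addrA lerDl addr_ge0.
  - by rewrite (le_trans (HB1 x))// addrAC lerDr addr_ge0.
  - by rewrite (le_trans (HB2 x))// lerDr addr_ge0.
have Lf := euclid_lipschitz B0 (fun i x => @df i x) HB.
have [C C0 HC] := bv S.
pose m := root4 M ^+ 3.
have m0 : 0 < m by rewrite exprn_gt0// root4_gt0.
have r40 := root4_ge0 S.
have z1 : 0 <= A * C by rewrite mulr_ge0.
have z2 : 0 <= `|v0| * (3 * B * root4 S) by apply: mulr_ge0 => //; apply: mulr_ge0 => //; apply: mulr_ge0.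
have z3 : 0 <= `|v0 * f 0| / m by rewrite divr_ge0// ltW.
exists (A * C + `|v0| * (3 * B * root4 S) + `|v0 * f 0| / m); first by rewrite addr_ge0// addr_ge0.
move=> n x; have s0 := rad_gt0 n x; have rs0 := root4_gt0 s0.
have xr : euclid x <= radius (e n) x by apply: euclid_le_radius; exact: ltW.
have p0 : 0 <= root4 (radius (e n) x) ^+ 3 by rewrite exprn_ge0// ltW.
have [bx|nx] := pselect (box M x); last first.
  rewrite Sf// mul0r sub0r normrN.
  apply: (@le_trans _ _ (`|v0 * f 0| / m * root4 (radius (e n) x) ^+ 3)).
    rewrite -mulrA ler_peMr// mulrC ler_pdivlMr// mul1r.
    apply: lerXn2r; rewrite ?nnegrE ?root4_ge0//; apply: le_root4.
    by rewrite (le_trans _ xr)// not_box_euclid.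
  by rewrite ler_wpM2r// lerDr addr_ge0.
have -> : f x * v (radius (e n) x) - v0 * f 0 =
   f x * (v (radius (e n) x) - v0) + v0 * (f x - f 0) by ring.
apply: (le_trans (ler_normD _ _)); rewrite !normrM.
have h1 : `|f x| * `|v (radius (e n) x) - v0| <= A * (C * root4 (radius (e n) x) ^+ 3).
  by apply: ler_pM => //; exact: HC (rad_in n bx).
have h2 : `|v0| * `|f x - f 0| <= `|v0| * (3 * B * root4 S * root4 (radius (e n) x) ^+ 3).
  rewrite ler_wpM2l// (le_trans (Lf x))// -!mulrA ler_wpM2l// ler_wpM2l//.
  rewrite (le_trans xr)// -[leLHS](root4K (ltW s0)) exprS ler_wpM2r//.
  by apply: le_root4; case/andP: (rad_in n bx).
apply: (le_trans (lerD h1 h2)).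
rewrite [leRHS]mulrDl [X in _ <= X + _]mulrDl -(mulrA A) -(mulrA `|v0|) lerDl.
by rewrite -normrM; apply: mulr_ge0.
Qed.

Let T3_dom : exists C, forall n x, off_axes x -> `|T3 n x| <= C * dom3 x.
Proof.
have [D D0 HD] := flux_error.
exists (D * 8) => n x ox.
have s0 := rad_gt0 n x; have r0 := root4_gt0 s0.
have i5 : 0 <= radius (e n) x ^- 5 by rewrite invr_ge0 exprn_ge0// ltW.
rewrite /T3 [leLHS]normrM [`|radius _ _ ^- 5 * _|]normrM.
have h3 : `|3 * e n / (4 * pi)| <= e n.
  rewrite ger0_norm; last by rewrite mulr_ge0 ?invr_ge0 ?mulr_ge0// ltW.
  rewrite ler_pdivrMr ?mulr_gt0// mulrC ler_wpM2l ?(ltW (e_gt0 n))//.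
  by have := pi_ge2 R; lra.
rewrite (ger0_norm i5).
have h4 : radius (e n) x ^- 5 * `|f x * v (radius (e n) x) - v0 * f 0| <=
    radius (e n) x ^- 5 * (D * root4 (radius (e n) x) ^+ 3) by rewrite ler_wpM2l.
have h5 : 0 <= radius (e n) x ^- 5 * `|f x * v (radius (e n) x) - v0 * f 0| by apply: mulr_ge0.
apply: (@le_trans _ _ (e n * (radius (e n) x ^- 5 * (D * root4 (radius (e n) x) ^+ 3)))).
  by apply: ler_pM.
have h2 := peak_dominated s0 (ltW (e_gt0 n)) (e_le1 n) (e_le_rad n x).
have h1 := dom3_radial ox (euclid_le_radius x (ltW (e_gt0 n))).
rewrite (_ : _ * (_ * _) = D * (e n * radius (e n) x ^- 5 * root4 (radius (e n) x) ^+ 3)); last by ring.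
rewrite -[leRHS]mulrA; apply: ler_wpM2l => //; apply: (le_trans h2).
by apply: ler_wpM2l.
Qed.

Let e_cvg0 : e n @[n --> \oo] --> 0.
Proof.
rewrite (_ : 0 = (0 : R) ^+ 2); last by rewrite expr0n.
apply: (@cvg_comp _ _ _ (fun n => n.+1%:R^-1) (fun t : R => t ^+ 2)); first exact: cvg_harmonic.
exact: exprn_continuous.
Qed.

Let radial_cvg (g : R -> R) x : (forall s : R, 0 < s -> {for s, continuous g}) -> off_axes x ->
  g (radius (e n) x) @[n --> \oo] --> g (euclid x).
Proof.
move=> cg ox; apply: (@cvg_comp _ _ _ (fun n => radius (e n) x) g); first exact: cvg_radius.
by apply: cg; exact: off_axes_euclid.
Qed.

Let T1_cvg x : off_axes x -> T1 n x @[n --> \oo] --> laplacian f x * k (euclid x).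
Proof. by move=> ox; apply: cvgM; [exact: cvg_cst|exact: radial_cvg]. Qed.

Let T2_cvg x : off_axes x -> T2 n x @[n --> \oo] --> f x * q (euclid x).
Proof.
move=> ox; apply: cvgM; first exact: cvg_cst.
rewrite -[X in _ --> X]mulr1; apply: cvgM; first exact: radial_cvg.
rewrite [X in _ --> X](_ : _ = 1 - 0 * euclid x ^- 2); last by rewrite mul0r subr0.
apply: cvgB; first exact: cvg_cst.
by apply: cvgM => //; apply: (radial_cvg (cVn (n := 2))).
Qed.

Let T3_cvg x : off_axes x -> T3 n x @[n --> \oo] --> 0.
Proof.
move=> ox.
rewrite [X in _ --> X](_ : _ = (3 * 0 / (4 * pi)) * (euclid x ^- 5 * (f x * v (euclid x) - v0 * f 0))); last first.
  by rewrite mulr0 !mul0r.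
apply: cvgM.
  by apply: cvgM; [apply: cvgM => //; exact: cvg_cst|exact: cvg_cst].
apply: cvgM; first by apply: (radial_cvg (cVn (n := 5))).
by apply: cvgB; [apply: cvgM; [exact: cvg_cst|exact: radial_cvg]|exact: cvg_cst].
Qed.

Let T1_cont n : continuous (T1 n).
Proof.
move=> x; apply: cvgM; first exact: continuous_laplacian.
exact: (continuous_radial (e_gt0 n) ck).
Qed.

Let T2_cont n : continuous (T2 n).
Proof.
move=> x; apply: cvgM; first exact: cf.
apply: cvgM; first exact: (continuous_radial (e_gt0 n) cq).
apply: cvgB; first exact: cvg_cst.
apply: cvgM; first exact: cvg_cst.
exact: (continuous_radial (e_gt0 n) (cVn (n := 2))).
Qed.

Let T3_cont n : continuous (T3 n).
Proof.
move=> x; apply: cvgM; first exact: cvg_cst.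
apply: cvgM; first exact: (continuous_radial (e_gt0 n) (cVn (n := 5))).
apply: cvgB; last exact: cvg_cst.
by apply: cvgM; [exact: cf|exact: (continuous_radial (e_gt0 n) cv)].
Qed.

Let integral_T1 n : \int[leb3 R]_x T1 n x = \int[leb3 R]_x T2 n x + \int[leb3 R]_x T3 n x + v0 * f 0.
Proof.
have [C2 H2] := T2_dom; have [C3 H3] := T3_dom.
have i2 := integrable3_dominated (continuous_measurable3 (@T2_cont n)) (H2 n).
have i3 := integrable3_dominated (continuous_measurable3 (@T3_cont n)) (H3 n).
pose c := v0 * f 0 * (3 * e n / (4 * pi)).
pose P x : R := radius (e n) x ^- 5.
have P0 x : 0 <= P x by rewrite invr_ge0 exprn_ge0// ltW.
have cP : continuous P by exact: (continuous_radial (e_gt0 n) (cVn (n := 5))).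
have iP : (leb3 R).-integrable setT (EFin \o P).
  apply/integrableP; split; first by apply/measurable_EFinP; exact: continuous_measurable3.
  under eq_integral do rewrite /= ger0_norm//.
  by rewrite integral_radius5// ltry.
have icP : (leb3 R).-integrable setT (EFin \o (fun x => c * P x)).
  by have := @integrableZl _ _ _ (leb3 R) setT measurableT c _ iP; apply: eq_integrable.
have -> : v0 * f 0 = \int[leb3 R]_x (c * P x).
  rewrite RintegralZl// /Rintegral integral_radius5//= /c.
  have := e_gt0 n; move: (e n) => d d0; move: (pi : R) pi0 => p p0.
  by field; rewrite !lt0r_neq0.
rewrite -RintegralD//; have i23 := integrableD measurableT i2 i3.
rewrite -RintegralD//.
rewrite /T1 (green (e_gt0 n) dK dK1 cK2 sf Sf); apply: eq_Rintegral => x _.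
rewrite /K1 /K2 /T2 /T3 /c /P.
have -> : euclid x ^+ 2 = radius (e n) x ^+ 2 - e n by rewrite radius_sqr// addrK.
have := rad_gt0 n x; move: (radius (e n) x) (e n) => s d s0.
move: (v s) (q s) (f x) (f 0) (pi : R) pi0 => V Q F F0 p p0.
by field; rewrite !lt0r_neq0.
Qed.

(** Let e tend to 0 in [integral_T1]: the distributional Laplacian of k is q away from
    the origin, plus the limit v0 of the flux times delta. *)
Theorem radial_fundamental :
  [/\ (leb3 R).-integrable setT (EFin \o (fun x => laplacian f x * k (euclid x))),
      (leb3 R).-integrable setT (EFin \o (fun x => f x * q (euclid x))) &
      \int[leb3 R]_x (laplacian f x * k (euclid x)) =
      \int[leb3 R]_x (f x * q (euclid x)) + v0 * f 0].
Proof.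
have [C1 H1] := T1_dom; have [C2 H2] := T2_dom; have [C3 H3] := T3_dom.
have m1 : measurable_fun [set: mR3] (fun x => laplacian f x * k (euclid x)).
  apply: measurable_funM; first by apply: continuous_measurable3; exact: continuous_laplacian.
  exact: measurable_radial.
have m2 : measurable_fun [set: mR3] (fun x => f x * q (euclid x)).
  apply: measurable_funM; first by apply: continuous_measurable3; exact: cf.
  exact: measurable_radial.
have [i1 L1] := cvg_Rintegral3 (fun n => continuous_measurable3 (@T1_cont n)) m1 H1 T1_cvg.
have [i2 L2] := cvg_Rintegral3 (fun n => continuous_measurable3 (@T2_cont n)) m2 H2 T2_cvg.
have m3 : measurable_fun [set: mR3] (fun _ : R3 => 0 : R) by exact: measurable_cst.
have [_ L3] := cvg_Rintegral3 (fun n => continuous_measurable3 (@T3_cont n)) m3 H3 T3_cvg.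
split=> //.
have L : (\int[leb3 R]_x T2 n x + \int[leb3 R]_x T3 n x + v0 * f 0) @[n --> \oo] -->
   \int[leb3 R]_x (f x * q (euclid x)) + \int[leb3 R]_x (0 : R) + v0 * f 0.
  by apply: cvgD; [exact: cvgD|exact: cvg_cst].
have R0 : \int[leb3 R]_x (0 : R) = 0 by rewrite /Rintegral integral0.
rewrite R0 addr0 in L.
have LE : (fun n => \int[leb3 R]_x T1 n x) = (fun n => \int[leb3 R]_x T2 n x +
    \int[leb3 R]_x T3 n x + v0 * f 0) by apply/funext => n; exact: integral_T1.
rewrite LE in L1; exact: (cvg_unique _ L1 L).
Qed.

End Limit.

(** * The fundamental solution *)

Section CompactSets.
Variable R : realType.
Local Notation mR := (measurableTypeR R).
Local Notation R3 := (R * R * R)%type.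
Local Notation mR3 := (mR * mR * mR)%type.

Lemma compact_in_box (K : set R3) : compact K -> exists2 M : R, 0 < M & K `<=` box M.
Proof.
move=> /compact_bounded[B [_ HB]]; exists (`|B| + 1); first by rewrite ltr_wpDl.
have nB x : K x -> `|x| <= `|B| + 1.
  by apply: HB; rewrite (le_lt_trans (ler_norm B))// ltrDl.
move=> x /nB; rewrite prod_normE /= ge_max prod_normE /= ge_max => /andP[/andP[h0 h1] h2].
by apply/boxP => -[[|[|i]] i3]; rewrite /coord /=.
Qed.

Lemma integrable_radial_compact (k : R -> R) (K : set R3) : compact K ->
  (forall s, 0 < s -> {for s, continuous k}) ->
  (forall S, exists2 C, 0 <= C & forall s, 0 < s <= S -> `|k s| <= C / s) ->
  (leb3 R).-integrable K (EFin \o (fun x => k (euclid x))).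
Proof.
move=> cK ck bk; have [M M0 KM] := compact_in_box cK.
have mK : measurable (K : set mR3).
  apply: closed_measurable3; apply: compact_closed => //; exact: norm_hausdorff.
have [C C0 HC] := bk (2 * M); have [D D0 HD] := inv_sqr_dominated (2 * M).
pose F (x : R3) := \1_(box M) x * k (euclid x).
have iF : (leb3 R).-integrable setT (EFin \o F).
  apply: (@integrable3_dominated R F (C * (2 * M) * D)).
    apply: measurable_funM; last exact: measurable_radial.
    by apply: measurable_indic; exact: measurable_box.
  move=> x ox; rewrite /F indicE.
  have M1 : 0 <= 2 * M by rewrite mulr_ge0// ltW.
  have [xM|xM] := boolP (x \in (box M : set R3)); rewrite /=; last first.
    by rewrite mul0r normr0; apply: mulr_ge0; rewrite ?dom3_ge0// mulr_ge0// mulr_ge0.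
  rewrite mul1r; have s0 := off_axes_euclid ox.
  have sM : 0 < euclid x <= 2 * M.
    by rewrite s0/= euclid_le_box// ?ltW//; move: xM; rewrite inE.
  apply: (le_trans (HC _ sM)); rewrite -2![leRHS]mulrA ler_wpM2l//.
  have h := HD _ sM; have h' := dom3_radial ox (lexx _).
  apply: (@le_trans _ _ (2 * M * euclid x ^- 2)).
    have -> : (euclid x)^-1 = euclid x * euclid x ^- 2 by field; exact: lt0r_neq0.
    by rewrite ler_wpM2r ?invr_ge0 ?exprn_ge0 ?(ltW s0)//; case/andP: sM.
  rewrite ler_wpM2l//.
  by rewrite (le_trans h)// ler_wpM2l.
have := integrableS measurableT mK (@subsetT _ _) iF.
apply: eq_integrable => // x; rewrite inE => Kx /=.
by rewrite /F indicE mem_set ?mul1r//; exact: KM.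
Qed.

Lemma test_function_support (g : R3 -> R[i]) : test_function g ->
  exists2 M : R, 0 < M & supported M (ReF g) /\ supported M (ImF g).
Proof.
move=> [_ _ /compact_in_box[M M0 gM]]; exists M => //.
suff g0 x : ~ box M x -> g x = 0.
  by split=> x nx; rewrite /ReF /ImF g0.
move=> nx; apply: contrapT => /eqP gx; apply: nx; apply: gM.
by apply: subset_closure.
Qed.

End CompactSets.

Section Main.
Variable R : realType.
Variables Z kappa : R[i].
Local Notation R3 := (R * R * R)%type.
Implicit Types (l : R[i]).

Definition kA_part l (s : R) : R := complex.Re (l * kA Z kappa s).
(** The value that A k_A = 0 prescribes for the Laplacian of k_A off the origin. *)
Definition source_part l (s : R) : R :=
  complex.Re (l * ((2 * kappa ^+ 2 - 2 * Z / s%:C) * kA Z kappa s)).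

Lemma continuous_kA_part l (s : R) : 0 < s -> {for s, continuous (kA_part l)}.
Proof.
by move=> s0; exact: is_derive_continuous_at (is_derive_kA Z kappa l s0).
Qed.

Lemma source_partE l (s : R) :
  source_part l s = kA_part (l * (2 * kappa ^+ 2)) s - s^-1 * kA_part (l * (2 * Z)) s.
Proof.
rewrite /source_part /kA_part -Re_realM -raddfB /=; congr complex.Re.
by rewrite real_complexV; ring.
Qed.

Lemma continuous_source_part l (s : R) : 0 < s -> {for s, continuous (source_part l)}.
Proof.
move=> s0; rewrite (_ : source_part l = (fun s =>
   kA_part (l * (2 * kappa ^+ 2)) s - s^-1 * kA_part (l * (2 * Z)) s)); last first.
  by apply/funext => t; exact: source_partE.
apply: cvgB; first exact: continuous_kA_part.
apply: cvgM; last exact: continuous_kA_part.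
by apply: cvgV => //; exact: lt0r_neq0.
Qed.

Lemma source_part_bound l S : exists2 C, 0 <= C & forall s, 0 < s <= S ->
  `|source_part l s| <= C / s ^+ 2.
Proof.
have [A A0 HA] := kA_bound Z kappa (l * (2 * kappa ^+ 2)) S.
have [B B0 HB] := kA_bound Z kappa (l * (2 * Z)) S.
exists (A * `|S| + B); first by rewrite addr_ge0// mulr_ge0.
move=> s sS; have [s0 sS'] := andP sS; rewrite source_partE.
apply: (le_trans (ler_normB _ _)); rewrite [leRHS]mulrDl; apply: lerD.
  apply: (le_trans (HA s sS)); rewrite -mulrA ler_wpM2l//.
  have -> : s^-1 = s * s ^- 2 by field; exact: lt0r_neq0.
  by rewrite ler_wpM2r ?invr_ge0 ?exprn_ge0 ?(ltW s0)// (le_trans sS')// ler_norm.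
rewrite normrM (gtr0_norm (x := s^-1)) ?invr_gt0//.
have -> : B / s ^+ 2 = s^-1 * (B / s) by field; exact: lt0r_neq0.
by rewrite ler_wpM2l ?invr_ge0 ?(ltW s0)//; exact: HB sS.
Qed.

Lemma kA_part_fundamental l (f : R3 -> R) (M : R) : 0 < M -> smooth f -> supported M f ->
  [/\ (leb3 R).-integrable setT (EFin \o (fun x => laplacian f x * kA_part l (euclid x))),
      (leb3 R).-integrable setT (EFin \o (fun x => f x * source_part l (euclid x))) &
      \int[leb3 R]_x (laplacian f x * kA_part l (euclid x)) -
      \int[leb3 R]_x (f x * source_part l (euclid x)) = complex.Re l * f 0].
Proof.
move=> M0 sf Sf.
suff [i1 i2 ->] : [/\ (leb3 R).-integrable setT (EFin \o (fun x => laplacian f x * kA_part l (euclid x))),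
      (leb3 R).-integrable setT (EFin \o (fun x => f x * source_part l (euclid x))) &
      \int[leb3 R]_x (laplacian f x * kA_part l (euclid x)) =
      \int[leb3 R]_x (f x * source_part l (euclid x)) + complex.Re l * f 0].
  by split=> //; rewrite addrAC subrr add0r.
apply: (radial_fundamental (v := fun s => complex.Re (l * kA_flux Z kappa s)) _ _ _ _ _ _ M0 sf Sf).
- by move=> s; exact: is_derive_kA.
- by move=> s; exact: is_derive_kA_flux.
- by move=> s; exact: continuous_source_part.
- by move=> S; exact: kA_bound.
- by move=> S; exact: source_part_bound.
- by move=> S; exact: kA_flux_estimate.
Qed.

Let neg_i : R[i] := 0 +i* (-1).

Lemma Im_part (z : R[i]) : complex.Im z = complex.Re (neg_i * z).
Proof. by rewrite ReE /= mul0r sub0r mulN1r opprK. Qed.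

Lemma Re_part (z : R[i]) : complex.Re z = complex.Re (1 * z).
Proof. by rewrite mul1r. Qed.

Lemma integrable_kA : locally_integrableC (fun x : R3 => kA Z kappa (euclid x)).
Proof.
move=> K cK; split.
  have := @integrable_radial_compact R (kA_part 1) K cK (continuous_kA_part (l := 1)) (kA_bound Z kappa 1).
  by apply: eq_integrable; [apply: closed_measurable3; apply: compact_closed => //; exact: norm_hausdorff|];
   move=> x _ /=; rewrite /ReF Re_part.
have := @integrable_radial_compact R (kA_part neg_i) K cK (continuous_kA_part (l := neg_i)) (kA_bound Z kappa neg_i).
by apply: eq_integrable; [apply: closed_measurable3; apply: compact_closed => //; exact: norm_hausdorff|];
  move=> x _ /=; rewrite /ImF Im_part.
Qed.

(** The terms of A of order zero are moved to the factor k_A. *)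
Lemma integrandE (g : R3 -> R[i]) (x : R3) :
  opA_Pf_integrand Z kappa (kA Z kappa) g x =
  laplacianC g x * kA Z kappa (euclid x) -
  g x * ((2 * kappa ^+ 2 - 2 * Z / (euclid x)%:C) * kA Z kappa (euclid x)).
Proof. by rewrite /opA_Pf_integrand /opA; ring. Qed.

Lemma Re_mulB (z w u q : R[i]) : complex.Re (z * w - u * q) =
  (complex.Re z * complex.Re w - complex.Re u * complex.Re q) -
  (complex.Im z * complex.Im w - complex.Im u * complex.Im q).
Proof. by case: z w u q => [? ?] [? ?] [? ?] [? ?] /=; ring. Qed.

Lemma Im_mulB (z w u q : R[i]) : complex.Im (z * w - u * q) =
  (complex.Re z * complex.Im w - complex.Re u * complex.Im q) +
  (complex.Im z * complex.Re w - complex.Im u * complex.Re q).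
Proof. by case: z w u q => [? ?] [? ?] [? ?] [? ?] /=; ring. Qed.

Lemma recombine (a b : R) :
  (complex.Re (1 : R[i]) * a - complex.Re neg_i * b) +i*
  (complex.Re neg_i * a + complex.Re (1 : R[i]) * b) = a +i* b.
Proof. by rewrite /= !mul1r !mul0r subr0 add0r. Qed.

Lemma Rintegral_subB (A B C D : R3 -> R) (a c : R) :
  (leb3 R).-integrable setT (EFin \o A) -> (leb3 R).-integrable setT (EFin \o B) ->
  (leb3 R).-integrable setT (EFin \o C) -> (leb3 R).-integrable setT (EFin \o D) ->
  \int[leb3 R]_x A x - \int[leb3 R]_x B x = a ->
  \int[leb3 R]_x C x - \int[leb3 R]_x D x = c ->
  \int[leb3 R]_x ((A x - B x) - (C x - D x)) = a - c.
Proof.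
move=> iA iB iC iD <- <-; have iAB := integrableB measurableT iA iB.
by have iCD := integrableB measurableT iC iD; rewrite RintegralB// !RintegralB.
Qed.

Lemma Rintegral_subD (A B C D : R3 -> R) (a c : R) :
  (leb3 R).-integrable setT (EFin \o A) -> (leb3 R).-integrable setT (EFin \o B) ->
  (leb3 R).-integrable setT (EFin \o C) -> (leb3 R).-integrable setT (EFin \o D) ->
  \int[leb3 R]_x A x - \int[leb3 R]_x B x = a ->
  \int[leb3 R]_x C x - \int[leb3 R]_x D x = c ->
  \int[leb3 R]_x ((A x - B x) + (C x - D x)) = a + c.
Proof.
move=> iA iB iC iD <- <-; have iAB := integrableB measurableT iA iB.
by have iCD := integrableB measurableT iC iD; rewrite RintegralD// !RintegralB.
Qed.

Lemma kA_fundamental (g : R3 -> R[i]) : test_function g ->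
  integrableC setT (opA_Pf_integrand Z kappa (kA Z kappa) g) /\
  opA_Pf Z kappa (kA Z kappa) g = delta g.
Proof.
move=> tg; have [M M0 [Sr Si]] := test_function_support tg; have [sr si _] := tg.
have [i1 i2 e12] := kA_part_fundamental 1 M0 sr Sr.
have [i3 i4 e34] := kA_part_fundamental neg_i M0 sr Sr.
have [i5 i6 e56] := kA_part_fundamental 1 M0 si Si.
have [i7 i8 e78] := kA_part_fundamental neg_i M0 si Si.
have ER : ReF (opA_Pf_integrand Z kappa (kA Z kappa) g) = (fun x =>
   (laplacian (ReF g) x * kA_part 1 (euclid x) - ReF g x * source_part 1 (euclid x)) -
   (laplacian (ImF g) x * kA_part neg_i (euclid x) - ImF g x * source_part neg_i (euclid x))).
  apply/funext => x; rewrite [LHS]/ReF integrandE Re_mulB.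
  by rewrite /kA_part /source_part -!Im_part -!Re_part.
have EI : ImF (opA_Pf_integrand Z kappa (kA Z kappa) g) = (fun x =>
   (laplacian (ReF g) x * kA_part neg_i (euclid x) - ReF g x * source_part neg_i (euclid x)) +
   (laplacian (ImF g) x * kA_part 1 (euclid x) - ImF g x * source_part 1 (euclid x))).
  apply/funext => x; rewrite [LHS]/ImF integrandE Im_mulB.
  by rewrite /kA_part /source_part -!Im_part -!Re_part.
have j12 := integrableB measurableT i1 i2.
have j34 := integrableB measurableT i3 i4.
have j56 := integrableB measurableT i5 i6.
have j78 := integrableB measurableT i7 i8.
split.
  split; first by rewrite ER; exact: (integrableB measurableT j12 j78).
  by rewrite EI; exact: (integrableD measurableT j34 j56).
rewrite /opA_Pf /integralC ER EI (Rintegral_subB i1 i2 i7 i8 e12 e78).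
rewrite (Rintegral_subD i3 i4 i5 i6 e34 e56) recombine /delta /ReF /ImF.
by case: (g 0).
Qed.

End Main.

Theorem proposition7 (R : realType) (Z kappa : R[i]) :
  [/\ (* the series defining k_A converges for every r > 0 *)
      (forall r : R, 0 < r -> cvgn (kA_partial Z kappa r)),
      (* Pf. k_A is a regular distribution *)
      locally_integrableC (fun x : R * R * R => kA Z kappa (euclid x)) &
      (* A (Pf. k_A) = delta, tested against every g in D(R^3) *)
      forall g : R * R * R -> R[i], test_function g ->
        integrableC setT (opA_Pf_integrand Z kappa (kA Z kappa) g) /\
        opA_Pf Z kappa (kA Z kappa) g = delta g].
Proof.
split.
- by move=> r _; apply: cvgP; exact: kA_cvg.
- exact: integrable_kA.
- by move=> g; exact: kA_fundamental.
Qed.
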